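(* Assume that $F\in\mathcal{C}^\infty(\mathbb{R}^d,\mathbb{R}^d)$ is bounded and globally Lipschitz continuous on $\mathbb{R}^d$. Let $T>0$ and $x=(q,p)\in\mathbb{R}^{2d}$. Let $(\overline{q}^q_t)_{t\ge 0}$ be the solution of the overdamped Langevin equation $\mathrm{d}\overline{q}_t=F(\overline{q}_t)\,\mathrm{d}t+\sqrt{2\beta^{-1}}\,\mathrm{d}B_t$ with $\overline q_0=q$, and, for $\gamma>0$, let $(q^{(\gamma),x}_t,p^{(\gamma),x}_t)_{t\geq 0}$ be the solution of the Langevin equation with friction $\gamma$ started at $x$. Let $Z\sim\mathcal{N}_d(0,\beta^{-1}I_d)$ be a Gaussian vector independent of the process $(\overline{q}^q_t)_{t\in[0,T]}$. Then the law of the couple $\big((q^{(\gamma),x}_{\gamma t})_{t\in[0,T]},\,p^{(\gamma),x}_{\gamma T}\big)$ converges weakly to the law of $\big((\overline{q}^q_t)_{t\in[0,T]},\,Z\big)$ when $\gamma\to\infty$.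
   Context: $d\ge1$ is an integer, $\beta>0$ is fixed (independent of $\gamma$), $F:\mathbb{R}^d\to\mathbb{R}^d$ does not depend on $\gamma$, and $(B_t)_{t\ge0}$ is a $d$-dimensional Brownian motion. For $\gamma>0$ and $x=(q,p)\in\mathbb{R}^d\times\mathbb{R}^d$, the Langevin process $(q^{(\gamma),x}_t,p^{(\gamma),x}_t)_{t\ge0}$ is the unique strong solution of $$\mathrm{d}q^{(\gamma)}_t=p^{(\gamma)}_t\,\mathrm{d}t,\qquad \mathrm{d}p^{(\gamma)}_t=F(q^{(\gamma)}_t)\,\mathrm{d}t-\gamma p^{(\gamma)}_t\,\mathrm{d}t+\sqrt{2\gamma\beta^{-1}}\,\mathrm{d}B_t,\qquad (q^{(\gamma)}_0,p^{(\gamma)}_0)=(q,p).$$ Weak convergence is convergence in distribution on $\mathcal{C}([0,T],\mathbb{R}^d)\times\mathbb{R}^d$, where $\mathcal{C}([0,T],\mathbb{R}^d)$ is endowed with the supremum norm. *)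

(* Defs.v *)
From HB Require Import structures.
From mathcomp Require Import all_boot all_order all_algebra.
From mathcomp Require Import all_classical all_reals all_analysis.

Set Implicit Arguments.
Unset Strict Implicit.
Unset Printing Implicit Defensive.
Set Warnings "-redundant-canonical-projection".

Import Order.TTheory GRing.Theory Num.Theory.
Import numFieldNormedType.Exports.

Local Open Scope classical_set_scope.
Local Open Scope ring_scope.

(* A process indexed by time is a function of a real time t and of w, and only
   its values at t >= 0 matter. Vectors of R^d are rows; the library norm on
   'rV[R]_d is the sup norm. *)

Section smoothness.
Context {R : realType} {d : nat}.
Implicit Type f : 'rV[R]_d -> 'rV[R]_d.

Definition partial (s : seq 'I_d) f : 'rV[R]_d -> 'rV[R]_d :=
  foldr (fun i g => 'D_(delta_mx ord0 i) g) f s.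

Definition smooth f : Prop := forall s : seq 'I_d,
  continuous (partial s f) /\
  forall (i : 'I_d) (x : 'rV[R]_d),
    derivable (partial s f) x (delta_mx ord0 i).

End smoothness.

Section random_vectors.
Context {R : realType} {disp : measure_display} {Omega : measurableType disp}.
Variable P : probability Omega R.
Context {d : nat}.

Definition generated_sigma {I : Type} (D : set I)
    (X : I -> Omega -> 'rV[R]_d) : set (set Omega) :=
  <<s [set A | exists t i (U : set R),
        [/\ D t, measurable U & A = (fun w => X t w ord0 i) @^-1` U]] >>.

Definition random_vector (X : Omega -> 'rV[R]_d) : Prop :=
  forall i, measurable_fun [set: Omega] (fun w => X w ord0 i).

Definition independent (G H : set (set Omega)) : Prop :=
  forall A B, G A -> H B -> P (A `&` B) = (P A * P B)%E.

Definition vector_sigma (X : Omega -> 'rV[R]_d) : set (set Omega) :=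
  generated_sigma [set: unit] (fun=> X).

(* The law N_d(0, s^2 I_d), s > 0: the d-fold product of N(0, s^2). The second
   parameter of [normal_prob] is the standard deviation. *)
Definition isotropic_gaussian (s : R) (X : Omega -> 'rV[R]_d) : Prop :=
  random_vector X /\
  forall U : 'I_d -> set R, (forall i, measurable (U i)) ->
    P [set w | forall i, U i (X w ord0 i)] =
    (\prod_(i < d) normal_prob 0 s (U i))%E.

Definition continuous_paths (X : R -> Omega -> 'rV[R]_d) : Prop :=
  forall w, {within `[0, +oo[, continuous (X ^~ w)}.

Definition brownian_motion (B : R -> Omega -> 'rV[R]_d) : Prop :=
  [/\ forall t, 0 <= t -> random_vector (B t),
      continuous_paths B,
      {ae P, forall w, B 0 w = 0},
      forall s t, 0 <= s -> s < t ->
        isotropic_gaussian (Num.sqrt (t - s)) (fun w => B t w - B s w) &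
      forall s t, 0 <= s -> s < t ->
        independent (vector_sigma (fun w => B t w - B s w))
                    (generated_sigma `[0, s] B)].

(* The filtration of B, augmented by the null events. *)
Definition augmented_filtration (B : R -> Omega -> 'rV[R]_d) (t : R) :
    set (set Omega) :=
  <<s generated_sigma `[0, t] B `|` [set N | measurable N /\ P N = 0%E] >>.

Definition adapted (B X : R -> Omega -> 'rV[R]_d) : Prop :=
  forall t i (U : set R), 0 <= t -> measurable U ->
    augmented_filtration B t ((fun w => X t w ord0 i) @^-1` U).

End random_vectors.

Section sde.
Context {R : realType} {disp : measure_display} {Omega : measurableType disp}.
Variable P : probability Omega R.
Context {d : nat}.
Implicit Types (F : 'rV[R]_d -> 'rV[R]_d) (B : R -> Omega -> 'rV[R]_d).

Definition time_integral (t : R) (f : R -> 'rV[R]_d) : 'rV[R]_d :=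
  \row_i (\int[lebesgue_measure]_(s in `[0, t]) f s ord0 i).

(* In both equations the diffusion coefficient is a constant c, so that the
   Ito integral of c against B over [0, t] is c *: (B t - B 0). *)

Definition langevin_solution F (beta gamma : R) B (q p : 'rV[R]_d)
    (Q V : R -> Omega -> 'rV[R]_d) : Prop :=
  [/\ continuous_paths Q /\ continuous_paths V,
      adapted P B Q /\ adapted P B V,
      {ae P, forall w, Q 0 w = q /\ V 0 w = p} &
      {ae P, forall w, forall t, 0 <= t ->
        Q t w = Q 0 w + time_integral t (V ^~ w) /\
        V t w = V 0 w + time_integral t (fun s => F (Q s w))
                - time_integral t (fun s => gamma *: V s w)
                + Num.sqrt (2 * gamma * beta^-1) *: (B t w - B 0 w)}].

Definition overdamped_solution F (beta : R) B (q : 'rV[R]_d)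
    (Q : R -> Omega -> 'rV[R]_d) : Prop :=
  [/\ continuous_paths Q,
      adapted P B Q,
      {ae P, forall w, Q 0 w = q} &
      {ae P, forall w, forall t, 0 <= t ->
        Q t w = Q 0 w + time_integral t (fun s => F (Q s w))
                + Num.sqrt (2 * beta^-1) *: (B t w - B 0 w)}].

End sde.

Section path_space.
Context {R : realType} {d : nat}.

Definition path_space (T : R) : Type :=
  continuousType (set_type `[0, T]) 'rV[R]_d.

HB.instance Definition _ (T : R) := Choice.on (path_space T).

(* The topology of the supremum norm. *)
HB.instance Definition _ (T : R) := PseudoMetric.copy (path_space T)
  (initial_topology
     (fun f : path_space T => f : arrow_uniform_type (set_type `[0, T]) 'rV[R]_d)).

(* The restriction of f to [0, T]; the zero path is a default value, used only
   if that restriction is not continuous. *)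
Definition restrict_path (T : R) (f : R -> 'rV[R]_d) : path_space T :=
  match pselect (continuous (sigL `[0, T] f)) with
  | left fc => mkcts fc : continuousType _ _
  | right _ => (cst (0 : 'rV[R]_d) : continuousType _ _)
  end.

End path_space.

Definition cvg_in_law {R : realType} {disp : measure_display}
    {Omega : measurableType disp} (P : probability Omega R)
    {E : topologicalType} (X : R -> Omega -> E) (Y : Omega -> E) : Prop :=
  forall f : E -> R, continuous f -> bounded_fun f ->
    ('E_P[f \o X gamma] @[gamma --> +oo%R] --> 'E_P[f \o Y])%E.

(* Main.v *)
(* In slow time, put Q_t = q_(gamma t), P_t = p_(gamma t) and W_t = B_(gamma t) / sqrt gamma,
   which is again a Brownian motion, and let c = sqrt (2 / beta). The equations combine into
   Q_t + P_t / gamma = q + p / gamma + int_0^t F(Q_s) ds + c W_t, and P / gamma tends to 0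
   uniformly because the damping beats the noise on any window of fixed length. So Q is close
   to the Euler scheme driven by the increments of W on a grid, which can be frozen on the
   last grid interval [T', T]; the friction makes P_T forget everything that precedes this interval,
   so that P_T is close to a weighted sum of the increments of W inside it.
   These increments are independent centred Gaussian vectors, hence the pair has the same law
   as the Euler scheme driven by B together with an increment B_(T' + v) - B_T', where the sum
   v of the variances is close to 1 / beta. This increment is independent of the frozen scheme,
   which is close to qbar, and may therefore be exchanged for Z.
   Errors are measured against Lipschitz functionals of the path, and the exceptional events
   are controlled by a functional of the oscillation of W, whose law does not depend on gamma. *)

Require Import Defs.
From mathcomp Require Import all_boot all_order all_algebra.
From mathcomp Require Import all_classical all_reals all_analysis.
From mathcomp Require Import measurable_realfun.
From mathcomp Require Import ring lra.
Set Implicit Arguments.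
Unset Strict Implicit.
Unset Printing Implicit Defensive.
Import Order.TTheory GRing.Theory Num.Theory.
Import numFieldNormedType.Exports.
Local Open Scope classical_set_scope.
Local Open Scope ring_scope.

(** * Bounded random variables *)

(** The noise W changes with gamma, so no closeness path by path to the limit is to be expected on
    the given space; only laws are compared. The passage from W to B is made on finitely many
    increments at a time, where equality of laws is checked on boxes; explicit Euler for the
    friction replaces an Ornstein-Uhlenbeck stochastic integral by such a finite sum. The truncated
    oscillation is itself a bounded Lipschitz functional of the path: it is measurable and
    transferred from W to B in the same way as the test functionals, and it dominates the indicator
    of the bad event. The parameters are chosen in the order coarse mesh, gamma, fine mesh. The fine
    mesh must depend on gamma, because in slow time the momentum relaxes on the scale gamma^-2 and
    receives the noise with a factor gamma; this is allowed because the lower bound imposed on gamma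
    does not involve the fine mesh. *)

Section bounded_expectation.
Context {R : realType} {disp : measure_display} {Omega : measurableType disp}.
Variable P : probability Omega R.
Implicit Types (X Y Z : Omega -> R) (M : R).

Definition bounded_rv M X := measurable_fun setT X /\ forall w, `|X w| <= M.

Lemma bounded_rv_integrable M X : bounded_rv M X ->
  P.-integrable setT (EFin \o X).
Proof.
move=> [mX bX]; apply: measurable_bounded_integrable => //.
  by apply: le_lt_trans (probability_le1 P measurableT) _; rewrite ltry.
exists M; split; first exact: num_real.
move=> y My w _ /=.
apply: (le_trans (bX w)); exact: ltW.
Qed.

Lemma bounded_rvD M N X Y : bounded_rv M X -> bounded_rv N Y ->
  bounded_rv (M + N) (fun w => X w + Y w).
Proof.
move=> [mX bX] [mY bY]; split; first exact: measurable_funD.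
by move=> w; rewrite (le_trans (ler_normD _ _))// lerD.
Qed.

Lemma bounded_rvB M N X Y : bounded_rv M X -> bounded_rv N Y ->
  bounded_rv (M + N) (fun w => X w - Y w).
Proof.
move=> [mX bX] [mY bY]; split; first exact: measurable_funB.
by move=> w; rewrite (le_trans (ler_normB _ _))// lerD.
Qed.

Lemma mean_cst r : \int[P]_w r = r.
Proof.
by rewrite Rintegral_cst// [X in fine X](probability_setT P) mulr1.
Qed.

Lemma ae_le_expectation M N X Y : bounded_rv M X -> bounded_rv N Y ->
  {ae P, forall w, X w <= Y w} -> \int[P]_w X w <= \int[P]_w Y w.
Proof.
move=> bX bY XY; rewrite -subr_ge0 -RintegralB//; last 2 first.
- exact: bounded_rv_integrable bY.
- exact: bounded_rv_integrable bX.
have bD := bounded_rvB bY bX.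
(* The difference is nonnegative only almost everywhere; its positive part is so everywhere and has
   the same integral. *)
have <- : \int[P]_w Num.max 0 (Y w - X w) = \int[P]_w (Y w - X w).
  rewrite /Rintegral; congr fine; apply: ae_eq_integral => //.
  - by apply/measurable_EFinP; apply: measurable_maxr => //; case: bD.
  - by apply/measurable_EFinP; case: bD.
  - by apply: filterS XY => w XY _; rewrite max_r// subr_ge0.
by apply: Rintegral_ge0 => w _; rewrite le_max lexx.
Qed.

Lemma ae_expectation_close M N K X Y Z :
    bounded_rv M X -> bounded_rv N Y -> bounded_rv K Z ->
  {ae P, forall w, `|X w - Y w| <= Z w} ->
  `|\int[P]_w X w - \int[P]_w Y w| <= \int[P]_w Z w.
Proof.
move=> bX bY bZ XYZ; have bD := bounded_rvB bX bY.
rewrite -RintegralB//; last 2 first.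
- exact: bounded_rv_integrable bX.
- exact: bounded_rv_integrable bY.
apply: le_trans (le_normr_Rintegral _ _) _ => //.
  exact: bounded_rv_integrable bD.
apply: (@ae_le_expectation (M + N) K _ _ _ bZ XYZ).
by split => [|w]; [apply: measurableT_comp => //; case: bD|rewrite normr_id; case: bD].
Qed.

(** Measurability of the limit is part of the conclusion: this is how functionals of whole paths
    become random variables. *)
Lemma bounded_convergence M (X_ : nat -> Omega -> R) X :
  (forall n, bounded_rv M (X_ n)) -> (forall w, X_ ^~ w @ \oo --> X w) ->
  bounded_rv M X /\ (fun n => \int[P]_w X_ n w) @ \oo --> \int[P]_w X w.
Proof.
move=> bX cX; have mX : measurable_fun setT X.
  by apply: (@measurable_fun_cvg _ _ _ _ X_) => [n|w _]; [case: (bX n)|exact: cX].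
have bM : bounded_rv M X.
  split=> // w; have cn : (fun n => `|X_ n w|) @ \oo --> `|X w| by apply: cvg_norm; exact: cX.
  rewrite -(cvg_lim _ cn)//; apply: limr_le; first exact: cvgP cn.
  by apply: nearW => n; case: (bX n).
split => //.
have [||||//|_ _] := @dominated_convergence _ _ _ P setT measurableT
  (fun n w => (X_ n w)%:E) (fun w => (X w)%:E) (cst M%:E).
- by move=> n; apply/measurable_EFinP; case: (bX n).
- exact/measurable_EFinP.
- by apply: aeW => w _; apply: cvg_EFin; [exact: nearW|exact: cX].
- by apply: finite_measure_integrable_cst.
- by apply: aeW => w n _; rewrite /= lee_fin; case: (bX n).
move=> h; apply: fine_cvg.
rewrite fineK//; apply: integrable_fin_num => //.
exact: bounded_rv_integrable bM.
Qed.

End bounded_expectation.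

(** * Finite-dimensional laws *)

Section rounding.
Context {R : realType}.

Definition grid_round (n : nat) (x : R) : R :=
  (Num.floor (x * n.+1%:R))%:~R / n.+1%:R.

Lemma grid_round_close n x : `|x - grid_round n x| <= n.+1%:R^-1.
Proof.
rewrite /grid_round; have /andP[h1 h2] := floor_itv (x * n.+1%:R).
have n0 : 0 < n.+1%:R :> R by [].
have -> : x - (Num.floor (x * n.+1%:R))%:~R / n.+1%:R =
  (x * n.+1%:R - (Num.floor (x * n.+1%:R))%:~R) / n.+1%:R.
  by rewrite mulrBl mulfK// gt_eqF.
rewrite normrM normfV (gtr0_norm n0) ler_piMl ?invr_ge0//.
rewrite ger0_norm ?subr_ge0// lerBlDl.
by move: h2; rewrite intrD mulr1z => /ltW.
Qed.

Lemma measurable_floor_level (c : int) :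
  measurable [set x : R | Num.floor x = c].
Proof.
rewrite [X in measurable X](_ : _ = `[c%:~R, (c + 1)%:~R[%classic)//.
by apply/seteqP; split => x /=; rewrite in_itv/=; [move=> <-; exact: floor_itv|exact: floor_def].
Qed.

End rounding.

Section finite_dimensional_laws.
Context {R : realType} {disp : measure_display} {Omega : measurableType disp}.
Variable P : probability Omega R.
Context {J : finType}.
Implicit Types (V : Omega -> J -> R) (H : (J -> R) -> R).

(** Continuity on R^J for the maximum norm, spelled out so that the function type needs no
    topology. *)
Definition finitely_continuous H := forall x e, 0 < e ->
  exists2 r, 0 < r & forall y, (forall j, `|x j - y j| <= r) -> `|H x - H y| <= e.

(** The rounded coordinates form a vector of integers, coded by one natural number: on the discrete
    space [nat] every function is measurable. The default value 0 of [decode] is never met on the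
    image of [code]. *)
Let cell n V w : {ffun J -> int} := [ffun j => Num.floor (V w j * n.+1%:R)].
Let code n V w : nat := pickle (cell n V w).
Let decode n H (k : nat) : R := if @unpickle {ffun J -> int} k is Some c
  then H (fun j => (c j : int)%:~R / n.+1%:R) else 0.

Let decode_code n V H w :
  decode n H (code n V w) = H (fun j => grid_round n (V w j)).
Proof.
rewrite /decode /code pickleK; congr H; apply/funext => j.
by rewrite /cell ffunE.
Qed.

Let cell_levels n V (c : {ffun J -> int}) :
  [set w | cell n V w = c] =
  [set w | forall j, [set x | Num.floor (x * n.+1%:R) = c j] (V w j)].
Proof.
apply/seteqP; split => w /=.
  by move=> <- j; rewrite /cell ffunE.
by move=> h; apply/ffunP => j; rewrite /cell ffunE.
Qed.

Let level_measurable n (k : int) :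
  measurable [set x : R | Num.floor (x * n.+1%:R) = k].
Proof.
have mf : measurable_fun [set: R] (fun x : R => x * n.+1%:R).
  exact: measurable_funM.
have := mf measurableT _ (measurable_floor_level k).
by rewrite setTI.
Qed.

Lemma measurable_box V (U : J -> set R) :
  (forall j, measurable_fun setT (V ^~ j)) -> (forall j, measurable (U j)) ->
  measurable [set w | forall j, U j (V w j)].
Proof.
move=> mV mU.
rewrite [X in measurable X](_ : _ = \bigcap_(j in [set: J]) ((V ^~ j) @^-1` U j)).
  apply: fin_bigcap_measurable => // j _; rewrite -[X in measurable X]setTI.
  exact: mV.
by apply/seteqP; split => w /= h j; [move=> _; exact: h|exact: h].
Qed.

(** A number may be decoded by [unpickle] without being the code of the result; the test
    [pickle c == k] discards such numbers, whose level set is empty. *)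
Let code_level n V k : [set w | code n V w = k] =
  if @unpickle {ffun J -> int} k is Some c then
    if pickle c == k then [set w | cell n V w = c] else set0 else set0.
Proof.
case E : unpickle => [c|]; last first.
  by apply/seteqP; split => w //= ck; move: E; rewrite -ck /code pickleK.
case: eqP => ck; apply/seteqP; split => w //=.
- by rewrite -ck /code => /(congr1 (@unpickle {ffun J -> int})); rewrite !pickleK => -[].
- by rewrite /code => ->.
- by move=> h; apply: ck; move: E; rewrite -h /code pickleK => -[<-].
Qed.

Let code_measurable n V : (forall j, measurable_fun setT (V ^~ j)) ->
  measurable_fun setT (code n V).
Proof.
move=> mV _ A _; rewrite setTI.
rewrite [X in measurable X](_ : _ = \bigcup_(k in A) [set w | code n V w = k]); last first.
  by apply/seteqP; split => w /= => [Aw|[k Ak /= ->//]]; exists (code n V w).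
apply: bigcup_measurable => k _; rewrite code_level.
case: unpickle => // c; case: eqP => // _; rewrite cell_levels.
exact: (measurable_box (U := fun j => [set x | Num.floor (x * n.+1%:R) = c j])).
Qed.

Let rounded M n V H : (forall j, measurable_fun setT (V ^~ j)) ->
  (forall x, `|H x| <= M) ->
  bounded_rv M (fun w => H (fun j => grid_round n (V w j))).
Proof.
move=> mV bH; split => [|w]; last exact: bH.
have -> : (fun w => H (fun j => grid_round n (V w j))) = decode n H \o code n V.
  by apply/funext => w /=; rewrite decode_code.
by apply: measurableT_comp => //; exact: code_measurable.
Qed.

Let rounded_cvg V H w : finitely_continuous H ->
  H (fun j => grid_round n (V w j)) @[n --> \oo] --> H (V w).
Proof.
move=> cH; apply/cvgrPdist_le => e e0; have [r r0 hr] := cH (V w) e e0.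
near=> n; apply: hr => j; apply: le_trans (grid_round_close _ _) _.
by apply: ltW; near: n; exact: (near_infty_natSinv_lt (PosNum r0)).
Unshelve. all: by end_near. Qed.

Lemma bounded_rv_finitely_continuous M V H :
  (forall j, measurable_fun setT (V ^~ j)) ->
  finitely_continuous H -> (forall x, `|H x| <= M) ->
  bounded_rv M (fun w => H (V w)).
Proof.
move=> mV cH bH.
have [||h _] := @bounded_convergence _ _ _ P M
  (fun n w => H (fun j => grid_round n (V w j))) (fun w => H (V w)) => //.
- by move=> n; exact: rounded.
- by move=> w; exact: (@rounded_cvg V H w cH).
Qed.

(** After rounding, [H] depends on a countable code whose level sets are boxes, so the two rounded
    expectations agree; bounded convergence then refines the mesh. *)
Lemma expectation_eq_boxes M V V' H :
  (forall j, measurable_fun setT (V ^~ j)) ->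
  (forall j, measurable_fun setT (V' ^~ j)) ->
  finitely_continuous H -> (forall x, `|H x| <= M) ->
  (forall U : J -> set R, (forall j, measurable (U j)) ->
    P [set w | forall j, U j (V w j)] = P [set w | forall j, U j (V' w j)]) ->
  \int[P]_w H (V w) = \int[P]_w H (V' w).
Proof.
move=> mV mV' cH bH eqP_.
have cvgE V0 : (forall j, measurable_fun setT (V0 ^~ j)) ->
    \int[P]_w H (fun j => grid_round n (V0 w j)) @[n --> \oo] --> \int[P]_w H (V0 w).
  move=> mV0; have [||_ //] := @bounded_convergence _ _ _ P M
    (fun n w => H (fun j => grid_round n (V0 w j))) (fun w => H (V0 w)) => //.
  - by move=> n; exact: rounded.
  - by move=> w; exact: (@rounded_cvg V0 H w cH).
apply: cvg_unique (cvgE _ mV) _ => //.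
suff -> : (fun n => \int[P]_w H (fun j => grid_round n (V w j))) =
    (fun n => \int[P]_w H (fun j => grid_round n (V' w j))) by exact: cvgE.
apply/funext => n; rewrite /Rintegral; congr fine.
(* The expectation is moved to the law of the code on [nat], a measure determined by its values at
   points. *)
have pushE V0 : (forall j, measurable_fun setT (V0 ^~ j)) ->
    exists2 X : {mfun Omega >-> nat}, (X : Omega -> nat) = code n V0 &
    (\int[P]_w (H (fun j => grid_round n (V0 w j)))%:E =
     \int[distribution P X]_k (decode n H k)%:E)%E.
  move=> mV0; have mC : measurable_fun setT (code n V0) by exact: code_measurable.
  exists (mfun_Sub (mem_set mC)) => //.
  rewrite integral_distribution//; last first.
    apply: (@bounded_rv_integrable _ _ _ P M); have [h1 h2] := rounded n mV0 bH.
    by split => [|w] /=; [apply: measurableT_comp => //|rewrite decode_code].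
  by apply: eq_integral => w _ /=; rewrite decode_code.
have [X XE ->] := pushE _ mV; have [X' X'E ->] := pushE _ mV'.
apply: eq_measure_integral => A _ _.
have -> : A = \bigcup_(k in A) [set k].
  by apply/seteqP; split => k /= => [Ak|[j Aj ->//]]; exists k.
rewrite !measure_bigcup//; try by apply/trivIsetP => i j _ _ ij; apply/seteqP; split => k //= [->]; exact/eqP.
have levelE V0 (Y : {mfun Omega >-> nat}) k : (Y : Omega -> nat) = code n V0 ->
    distribution P Y [set k] = P [set w | code n V0 w = k].
  by move=> <-.
apply: eq_eseriesr => k _; rewrite [LHS](levelE V X k XE) [RHS](levelE V' X' k X'E) !code_level; case: unpickle => [c|]; last by rewrite !measure0.
case: ifP => _; last by rewrite !measure0.
by rewrite !cell_levels; exact: (eqP_ (fun j => [set x | Num.floor (x * n.+1%:R) = c j])).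
Qed.

End finite_dimensional_laws.

(** * Gaussian and Brownian increments *)

Section normal_scaling.
Context {R : realType}.
Notation mu := (@lebesgue_measure R).

Let normal_pdf_scale (a s x : R) : 0 < a -> 0 < s ->
  normal_pdf 0 (a * s) (a * x) * a = normal_pdf 0 s x.
Proof.
move=> a0 s0; rewrite !normal_pdfE ?mulf_neq0 ?gt_eqF//.
rewrite /normal_peak /normal_fun !subr0.
rewrite mulrAC; congr (_ * _); last first.
  by congr expR; field; rewrite !gt_eqF.
rewrite exprMn -mulrA -mulrnAr sqrtrM ?sqr_ge0// sqrtr_sqr gtr0_norm//.
by rewrite invfM mulrAC mulVf ?gt_eqF// mul1r.
Qed.

(** Closed half-lines form a generating pi-system that exhausts the line, so by uniqueness of
    measures it is enough to treat them; there the claim is the substitution y = a x in the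
    density. *)
Lemma normal_prob_scale (a s : R) (U : set R) : 0 < a -> 0 < s -> measurable U ->
  normal_prob 0 s ((fun x => a * x) @^-1` U) = normal_prob 0 (a * s) U.
Proof.
move=> a0 s0 mU.
have mf : measurable_fun [set: R] (fun x : R => a * x) by exact: measurable_funM.
have mf' : measurable_fun [set: measurableTypeR R] ((fun x : R => a * x) : _ -> measurableTypeR R).
  exact: mf.
pose phi := @mfun_Sub _ _ (measurableTypeR R) (measurableTypeR R) _ (mem_set mf').
suff : distribution (normal_prob 0 s) phi U = normal_prob 0 (a * s) U by [].
apply: (@measure_unique _ R (measurableTypeR R) (@RGenCInfty.G R)
  (fun n => `[- n%:R, +oo[%classic) _ _ _ _
  (distribution (normal_prob 0 s) phi) (normal_prob 0 (a * s))).
- exact: RGenCInfty.measurableE.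
- move=> _ _ [x ->] [y ->]; exists (Num.max x y).
  apply/seteqP; split => z /=; rewrite !in_itv/= !andbT.
    by move=> [xz yz]; rewrite ge_max xz.
  by rewrite ge_max => /andP.
- by move=> i; exists (- i%:R).
- apply/seteqP; split => // x _; exists (Num.bound `|x|) => //=.
  rewrite in_itv/= andbT lerNl (le_trans (ler_norm _))// normrN.
  by apply/ltW; exact: archi_boundP (normr_ge0 x).
- move=> _ [x ->].
  transitivity (normal_prob 0 s `[x / a, +oo[%classic).
    rewrite /distribution /pushforward/=; congr (normal_prob 0 s _).
    by apply/seteqP; split => z /=; rewrite !in_itv/= !andbT ler_pdivrMr// mulrC.
  rewrite /normal_prob.
  have DF : (fun x0 : R => a * x0)^`()%classic = cst a.
    apply/funext => z; rewrite derive1E (_ : (fun x0 => a * x0) = a \*: (@idfun R))//.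
    by rewrite deriveZ//= derive_id; exact: mulr1.
  have E : x = a * (x / a) by rewrite mulrCA mulfV ?gt_eqF// mulr1.
  transitivity (\int[mu]_(z in `[(x / a)%R, +oo[)
      ((((normal_pdf 0 (a * s) \o (fun x => a * x)) * (fun x0 : R => a * x0)^`()%classic) z)%R)%:E)%E.
    by apply: eq_integral => z _; rewrite DF/= -(normal_pdf_scale z a0 s0).
  rewrite [in RHS]E; apply/esym.
  apply: (@increasing_ge0_integration_by_substitutiony _ (fun x => a * x)).
  + by move=> y z _ _; rewrite ltr_pM2l.
  + by move=> z _; rewrite DF; exact: cst_continuous.
  + by rewrite DF; exact: is_cvg_cst.
  + by rewrite DF; exact: is_cvg_cst.
  + split; first by move=> z _; exact: derivableM.
    by apply: cvgM; [exact: cvg_cst|exact: cvg_at_right_filter].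
  + by apply/gt0_cvgMry => //; exact: cvg_id.
  + apply: continuous_subspaceT; apply: continuous_normal_pdf.
    by rewrite mulf_neq0 ?gt_eqF.
  + by move=> z _; exact: normal_pdf_ge0.
- by move=> k; apply: le_lt_trans (probability_le1 _ _) _; [exact: measurable_itv|rewrite ltry].
- exact: mU.
Qed.

End normal_scaling.

Section generated_sigma_algebras.
Context {R : realType} {disp : measure_display} {Omega : measurableType disp}.
Variable P : probability Omega R.
Context {d : nat}.

Section generated.
Context {I : Type}.
Variables (D : set I) (X : I -> Omega -> 'rV[R]_d).

Let gens : set (set Omega) := [set A | exists t i (U : set R),
  [/\ D t, measurable U & A = (fun w => X t w ord0 i) @^-1` U]].

Let measurable_coord t i : D t ->
  @measurable_fun _ _ (g_sigma_algebraType gens) R setT (fun w => X t w ord0 i).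
Proof.
move=> Dt _ U mU; rewrite setTI; apply: sub_sigma_algebra.
by exists t, i, U.
Qed.

Lemma generated_sigma_box {K : finType} (t : K -> I) (U : K -> 'I_d -> set R) :
  (forall k, D (t k)) -> (forall k i, measurable (U k i)) ->
  generated_sigma D X [set w | forall k i, U k i (X (t k) w ord0 i)].
Proof.
move=> Dt mU.
have := @measurable_box R _ (g_sigma_algebraType gens) _
  (fun w (ki : K * 'I_d) => X (t ki.1) w ord0 ki.2) (fun ki => U ki.1 ki.2).
have -> : [set w | forall j : K * 'I_d, U j.1 j.2 (X (t j.1) w ord0 j.2)] =
    [set w | forall k i, U k i (X (t k) w ord0 i)].
  by apply/seteqP; split => w /= h; [move=> k i; exact: (h (k, i))|move=> [k i]; exact: h].
by apply=> [[k i]|[k i]] /=; [exact: measurable_coord|exact: mU].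
Qed.

Lemma generated_sigma_increments {K : finType} (s t : K -> I) (U : K -> 'I_d -> set R) :
  (forall k, D (s k)) -> (forall k, D (t k)) -> (forall k i, measurable (U k i)) ->
  generated_sigma D X [set w | forall k i, U k i ((X (t k) w - X (s k) w) ord0 i)].
Proof.
move=> Ds Dt mU.
have := @measurable_box R _ (g_sigma_algebraType gens) _
  (fun w (ki : K * 'I_d) => (X (t ki.1) w - X (s ki.1) w) ord0 ki.2)
  (fun ki => U ki.1 ki.2).
have -> : [set w | forall j : K * 'I_d, U j.1 j.2 ((X (t j.1) w - X (s j.1) w) ord0 j.2)] =
    [set w | forall k i, U k i ((X (t k) w - X (s k) w) ord0 i)].
  by apply/seteqP; split => w /= h; [move=> k i; exact: (h (k, i))|move=> [k i]; exact: h].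
apply=> [[k i]|[k i]] /=; last exact: mU.
rewrite (_ : (fun w => _) = (fun w => X (t k) w ord0 i - X (s k) w ord0 i)).
  by apply: measurable_funB; exact: measurable_coord.
by apply/funext => w; rewrite !mxE.
Qed.

Lemma generated_sigma_measurable : (forall t, D t -> random_vector (X t)) ->
  generated_sigma D X `<=` measurable.
Proof.
move=> rX; apply: smallest_sub; first exact: sigma_algebra_measurable.
move=> _ [t [i [U [Dt mU ->]]]]; rewrite -[X in measurable X]setTI.
exact: rX.
Qed.

End generated.

Lemma vector_sigma_box (X : Omega -> 'rV[R]_d) (U : 'I_d -> set R) :
  (forall i, measurable (U i)) -> vector_sigma X [set w | forall i, U i (X w ord0 i)].
Proof.
move=> mU; have := @generated_sigma_box unit setT (fun=> X) unit (fun=> tt) (fun=> U) _ _.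
rewrite (_ : [set w | _] = [set w | forall i, U i (X w ord0 i)]); last first.
  by apply/seteqP; split => w /= h; [exact: (h tt)|move=> _].
by apply.
Qed.

Lemma ae_eq_measure (A A' : set Omega) : measurable A -> measurable A' ->
  {ae P, forall w, A w <-> A' w} -> P A = P A'.
Proof.
move=> mA mA' AA'.
rewrite -[in LHS](setIT A) -[in RHS](setIT A') -!integral_indic//.
apply: ae_eq_integral => //.
- exact/measurable_EFinP/measurable_indic.
- exact/measurable_EFinP/measurable_indic.
apply: filterS AA' => w AA' _; congr (_%:E); rewrite !indicE.
by have -> : (w \in A) = (w \in A') by apply/idP/idP; rewrite !inE => /AA'.
Qed.

Section augmented.
Variables (B : R -> Omega -> 'rV[R]_d).
Hypothesis B_rv : forall t, 0 <= t -> random_vector (B t).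
Variable t : R.

Let G_measurable : generated_sigma `[0, t] B `<=` measurable.
Proof. by apply: generated_sigma_measurable => s /=; rewrite in_itv/= => /andP[? _]; exact: B_rv. Qed.

Lemma augmented_filtration_measurable : augmented_filtration P B t `<=` measurable.
Proof.
apply: smallest_sub; first exact: sigma_algebra_measurable.
by move=> A [/G_measurable|[]].
Qed.

(** The events that agree almost everywhere with an event of the raw filtration form a sigma-algebra
    containing all generators, null events included. Independence of Brownian increments, which is
    assumed for the raw filtration, thus carries over to the augmented one. *)
Lemma augmented_filtration_ae (A : set Omega) : augmented_filtration P B t A ->
  exists2 A', generated_sigma `[0, t] B A' & {ae P, forall w, A w <-> A' w}.
Proof.
have [G0 GC GU] := smallest_sigma_algebra setT
  [set A | exists s i (U : set R), [/\ (`[0, t]%classic s : Prop), measurable U &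
     A = (fun w => B s w ord0 i) @^-1` U]].
move: A; apply: smallest_sub.
  split.
  - by exists set0 => //; exact: aeW.
  - move=> A [A' GA' AA']; exists (setT `\` A'); first exact: GC.
    by apply: filterS AA' => w [h1 h2]; split => -[_ h]; split => // /h1 || split => // /h2.
  - move=> A hA.
    have [A' hA'] : {A' : nat -> set Omega & forall n,
        generated_sigma `[0, t] B (A' n) /\ {ae P, forall w, A n w <-> A' n w}}.
      apply: (@choice _ _ (fun n A'n => generated_sigma `[0, t] B A'n /\
        {ae P, forall w, A n w <-> A'n w})) => n.
      by have [A' ? ?] := hA n; exists A'.
    exists (\bigcup_n A' n); first by apply: GU => n; case: (hA' n).
    have : {ae P, forall w n, A n w <-> A' n w}.
      by apply/ae_foralln => n; case: (hA' n).
    apply: filterS => w h; split => -[n _ /h ?]; by exists n.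
move=> A [GA|[mA A0]]; first by exists A => //; exact: aeW.
exists set0 => //; exists A; split => // w /=.
by apply: contra_notP => Aw; split.
Qed.

End augmented.
End generated_sigma_algebras.

Section brownian_laws.
Context {R : realType} {disp : measure_display} {Omega : measurableType disp}.
Variable P : probability Omega R.
Context {d : nat}.
Variable B : R -> Omega -> 'rV[R]_d.
Hypothesis B_brownian : brownian_motion P B.

Let B_rv t : 0 <= t -> random_vector (B t).
Proof. by case: B_brownian => + _ _ _ _ => /(_ t). Qed.

Lemma brownian_increment_box s t (U : 'I_d -> set R) : 0 <= s -> s < t ->
  (forall i, measurable (U i)) ->
  P [set w | forall i, U i ((B t w - B s w) ord0 i)] =
  (\prod_(i < d) normal_prob 0 (Num.sqrt (t - s)) (U i))%E.
Proof. by move=> s0 st mU; case: B_brownian => _ _ _ /(_ s t s0 st)[_] + _; exact. Qed.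

(** Induction on [N]: the last increment is independent of the past at time [s N], to which all
    earlier increments belong. *)
Lemma brownian_increments_box (s : nat -> R) (N : nat) (U : nat -> 'I_d -> set R) :
  0 <= s 0%N -> (forall k, s k < s k.+1) -> (forall k i, measurable (U k i)) ->
  P [set w | forall (k : 'I_N) i, U k i ((B (s k.+1) w - B (s k) w) ord0 i)] =
  (\prod_(k < N) \prod_(i < d) normal_prob 0 (Num.sqrt (s k.+1 - s k)) (U k i))%E.
Proof.
move=> s0 sS mU.
have s_homo : {homo s : m n / (m <= n)%N >-> m <= n}.
  by apply: homo_leq => //; [exact: le_trans|move=> n; exact: ltW].
have s_ge0 n : 0 <= s n by apply: (le_trans s0); exact: s_homo.
elim: N => [|N IH].
  rewrite big_ord0 (_ : [set w | _] = setT) ?[LHS]probability_setT//.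
  by apply/seteqP; split => w //= _ [].
rewrite big_ord_recr/= -IH.
have -> : [set w | forall (k : 'I_N.+1) i, U k i ((B (s k.+1) w - B (s k) w) ord0 i)] =
   [set w | forall i, U N i ((B (s N.+1) w - B (s N) w) ord0 i)] `&`
   [set w | forall (k : 'I_N) i, U k i ((B (s k.+1) w - B (s k) w) ord0 i)].
  apply/seteqP; split => w /= h.
    by split => [i|k i]; [exact: (h ord_max)|exact: (h (widen_ord (leqnSn N) k))].
  move=> k i; case: h => h1 h2; have [kN|] := ltnP k N; first exact: (h2 (Ordinal kN)).
  move=> Nk; have -> : (k : nat) = N by apply/eqP; rewrite eqn_leq Nk andbT -ltnS.
  exact: h1.
rewrite -brownian_increment_box// muleC.
case: B_brownian => _ _ _ _ /(_ (s N) (s N.+1) (s_ge0 N) (sS N)); apply.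
- exact: (@vector_sigma_box _ _ _ _ (fun w => B (s N.+1) w - B (s N) w)).
- apply: (@generated_sigma_increments _ _ _ _ _ `[0, s N]%classic B 'I_N (fun k => s k) (fun k => s k.+1) (fun k => U k)) => // k.
  + by rewrite /= in_itv/= s_ge0/= s_homo// ltnW.
  + by rewrite /= in_itv/= s_ge0/= s_homo.
Qed.

(* A sum of independent centred Gaussians is recognised here as an increment of B
   over an interval of length its variance. *)
Lemma scaled_brownian_increments_law (N : nat) (s s' a : nat -> R) (M : R)
    (H : ('I_N * 'I_d -> R) -> R) :
  0 <= s 0%N -> (forall k, s k < s k.+1) -> 0 <= s' 0%N ->
  (forall k, 0 < a k) -> (forall k, s' k.+1 - s' k = a k ^+ 2 * (s k.+1 - s k)) ->
  finitely_continuous H -> (forall x, `|H x| <= M) ->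
  \int[P]_w H (fun ki => a ki.1 * (B (s ki.1.+1) w - B (s ki.1) w) ord0 ki.2) =
  \int[P]_w H (fun ki => (B (s' ki.1.+1) w - B (s' ki.1) w) ord0 ki.2).
Proof.
move=> s0 sS s'0 a0 s'S cH bH.
have s'lt k : s' k < s' k.+1.
  by rewrite -subr_gt0 s'S mulr_gt0 ?exprn_gt0 ?subr_gt0.
have ge0 (u : nat -> R) n : 0 <= u 0%N -> (forall k, u k < u k.+1) -> 0 <= u n.
  by move=> u0 uS; elim: n => // n un; rewrite (le_trans un)// ltW.
have mB (u : nat -> R) k i : 0 <= u 0%N -> (forall k, u k < u k.+1) ->
    measurable_fun setT (fun w => (B (u k.+1) w - B (u k) w) ord0 i).
  move=> u0 uS; rewrite (_ : (fun w => _) =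
    (fun w => B (u k.+1) w ord0 i - B (u k) w ord0 i)).
    by apply: measurable_funB; apply: B_rv; exact: ge0.
  by apply/funext => w; rewrite !mxE.
apply: (@expectation_eq_boxes _ _ _ P _ M _ _ H _ _ cH bH).
- by move=> [k i] /=; apply: measurable_funM => //; exact: mB.
- by move=> [k i] /=; exact: mB.
move=> U mU.
(* The box is extended to all natural indices by trivial sides, the form that
   [brownian_increments_box] expects. *)
pose U' (k : nat) i := if insub k is Some k' then U (k', i) else setT.
have U'E (k : 'I_N) i : U' k i = U (k, i) by rewrite /U' valK.
have mU' k i : measurable (U' k i) by rewrite /U'; case: insub.
transitivity (\prod_(k < N) \prod_(i < d)
    normal_prob 0 (Num.sqrt (s' k.+1 - s' k)) (U' k i))%E; last first.
  rewrite -brownian_increments_box//; congr (P _).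
  by apply/seteqP; split => w /= h => [[k i]|k i]; [rewrite /= -U'E|rewrite U'E]; [|exact: (h (k, i))].
transitivity (\prod_(k < N) \prod_(i < d)
    normal_prob 0 (Num.sqrt (s k.+1 - s k)) ((fun x => (a k * x)%R) @^-1` U' k i))%E; last first.
  apply: eq_bigr => k _; apply: eq_bigr => i _.
  have sk : 0 < Num.sqrt (s k.+1 - s k) by rewrite sqrtr_gt0 subr_gt0.
  have -> : Num.sqrt (s' k.+1 - s' k) = a k * Num.sqrt (s k.+1 - s k).
    by rewrite s'S sqrtrM ?sqr_ge0// sqrtr_sqr gtr0_norm.
  exact: (normal_prob_scale (a0 k) sk (mU' k i)).
rewrite -(@brownian_increments_box s N (fun k i => (fun x => a k * x) @^-1` U' k i))//.
  congr (P _).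
  by apply/seteqP; split => w /= h => [k i|[k i]]; [rewrite U'E; exact: (h (k, i))|rewrite /= -U'E].
move=> k i; have mf : measurable_fun [set: R] (fun x : R => a k * x) by exact: measurable_funM.
by rewrite -[X in measurable X]setTI; exact: mf.
Qed.

(** Events about [X] up to time [s] belong to the augmented filtration at [s]; each is exchanged for
    an almost equal raw event, to which the independence in [brownian_motion] applies. *)
Lemma adapted_indep_increment (K : finType) (X : R -> Omega -> 'rV[R]_d)
    (u : K -> R) s t (U : K -> 'I_d -> set R) (V : 'I_d -> set R) :
  adapted P B X -> (forall k, 0 <= u k <= s) -> 0 <= s -> s < t ->
  (forall k i, measurable (U k i)) -> (forall i, measurable (V i)) ->
  P ([set w | forall i, V i ((B t w - B s w) ord0 i)] `&`
     [set w | forall k i, U k i (X (u k) w ord0 i)]) =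
  (\prod_(i < d) normal_prob 0 (Num.sqrt (t - s)) (V i) *
   P [set w | forall k i, U k i (X (u k) w ord0 i)])%E.
Proof.
move=> aX us s0 st mU mV.
have mono r : 0 <= r <= s -> augmented_filtration P B r `<=` augmented_filtration P B s.
  move=> /andP[r0 rs]; apply: sub_sigma_algebra2 => A [GA|?]; [left|by right].
  move: A GA; apply: sub_sigma_algebra2 => _ [v [i [W [/= + mW ->]]]].
  rewrite in_itv/= => /andP[v0 vr]; exists v, i, W; split => //=.
  by rewrite in_itv/= v0 (le_trans vr).
set A := [set w | forall k i, U k i (X (u k) w ord0 i)].
have [aug0 augC augU] := smallest_sigma_algebra setT
  (generated_sigma `[0, s] B `|` [set N | measurable N /\ P N = 0%E]).
have augA : augmented_filtration P B s A.
  have := @measurable_box R _ (g_sigma_algebraType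
     (generated_sigma `[0, s] B `|` [set N | measurable N /\ P N = 0%E])) (K * 'I_d)%type
    (fun w (ki : K * 'I_d) => X (u ki.1) w ord0 ki.2) (fun ki => U ki.1 ki.2).
  have -> : [set w | forall j : K * 'I_d, U j.1 j.2 (X (u j.1) w ord0 j.2)] = A.
    by apply/seteqP; split => w /= h; [move=> k i; exact: (h (k, i))|move=> [k i]; exact: h].
  apply => [[k i] _ W mW|[k i] /=]; last exact: mU.
  rewrite setTI; apply: (mono (u k)) => //.
  by apply: aX => //; case/andP: (us k).
have mA := augmented_filtration_measurable B_rv augA.
have [A' GA' AA'] := augmented_filtration_ae augA.
have mA' : measurable A'.
  apply: (generated_sigma_measurable _ GA') => r /=.
  by rewrite in_itv/= => /andP[r0 _]; exact: B_rv.
rewrite -brownian_increment_box//.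
set C := [set w | forall i, V i _].
have GC : vector_sigma (fun w => B t w - B s w) C by exact: (@vector_sigma_box _ _ _ _ (fun w => B t w - B s w)).
have mC : measurable C.
  apply: (generated_sigma_measurable _ GC) => _ _ i.
  rewrite (_ : (fun w => _) = (fun w => B t w ord0 i - B s w ord0 i)).
    by apply: measurable_funB; apply: B_rv => //; rewrite (le_trans s0)// ltW.
  by apply/funext => w; rewrite !mxE.
rewrite (@ae_eq_measure _ _ _ P A A')// (@ae_eq_measure _ _ _ P (C `&` A) (C `&` A')).
- by case: B_brownian => _ _ _ _ /(_ s t s0 st); exact.
- exact: measurableI.
- exact: measurableI.
- by apply: filterS AA' => w [h1 h2]; split => -[? ?]; split; auto.
Qed.

End brownian_laws.

(** * Paths and their oscillation *)

Section uniform_continuity.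
Context {R : realType} {d : nat}.
Implicit Types (x : R -> 'rV[R]_d).

Lemma rV_norm_le (v : 'rV[R]_d) e : 0 <= e ->
  (`|v| <= e) <-> (forall i, `|v ord0 i| <= e).
Proof.
move=> e0; rewrite [`|v|]/Num.norm/= mx_normrE; split => [h i|h].
  by apply: le_trans h; apply: (le_bigmax _ (fun ij : 'I_1 * 'I_d => `|v ij.1 ij.2|) (ord0, i)).
by apply/bigmax_leP; split => // -[i j] _ /=; rewrite ord1.
Qed.

Lemma rV_coord_norm_le (v : 'rV[R]_d) i : `|v ord0 i| <= `|v|.
Proof. by have /(rV_norm_le v)[+ _] : 0 <= `|v| by []; apply. Qed.

Definition uniformly_continuous_upto (S : R) x := forall e, 0 < e ->
  exists2 r, 0 < r & forall s t, 0 <= s <= S -> 0 <= t <= S ->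
    `|s - t| <= r -> `|x s - x t| <= e.

Lemma heine S x : {within `[0, +oo[, continuous x} -> uniformly_continuous_upto S x.
Proof.
move=> /subspace_continuousP cx e e0.
have : near_covering `[0, S] by exact/compact_near_coveringP/segment_compact.
move=> cov; have h : \forall r \near 0^'+, `[0, S]%classic `<=` (fun s => forall t,
    0 <= s <= S -> 0 <= t <= S -> `|s - t| <= r -> `|x s - x t| <= e).
  apply: cov.
  move=> s; rewrite /= in_itv/= => /andP[s0 sS].
  have s0' : `[0, +oo[%classic s by rewrite /= in_itv/= s0.
  have /cvgrPdist_le/(_ (e / 2)) := cx s s0'.
  rewrite divr_gt0// => /(_ isT); rewrite near_withinE => /nbhs_ballP[r /= r0 rx].
  (* Halving makes room for two moves: [s'] is within [r / 2] of [s] and [t] within [r / 2] of [s'],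
     so both stay in the ball of radius [r], where the path is within [e / 2] of its value at
     [s]. *)
  exists (ball s (r / 2), [set r' | 0 < r' < r / 2]); first split => /=.
  - by apply: nbhsx_ballx; rewrite divr_gt0.
  - near=> z; apply/andP; split; near: z; first exact: nbhs_right_gt.
    by apply: nbhs_right_lt; rewrite divr_gt0.
  move=> [s' r'] /= [ss' /andP[r'0 r'r]] t /andP[s'0 s'S] /andP[t0 tS] s't.
  have ss'r : `|s - s'| < r / 2 by [].
  rewrite (_ : x s' - x t = (x s - x t) - (x s - x s')); last by rewrite opprB [RHS]addrC subrKA.
  rewrite (splitr e); apply: le_trans (ler_normB _ _) _; rewrite lerD//.
    apply: rx; last by rewrite /= in_itv/= t0.
    rewrite /ball/= -(subrKA s') (le_lt_trans (ler_normD _ _))// (splitr r) ltr_leD//.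
    by rewrite (le_trans s't)// ltW.
  apply: rx; last by rewrite /= in_itv/= s'0.
  by apply: lt_le_trans ss'r _; rewrite ler_pdivrMr// ler_peMr ?ler1n// ltW.
have /filter_ex[r [r0 hr]] : \forall r \near 0^'+, 0 < r /\ `[0, S]%classic `<=` (fun s =>
    forall t, 0 <= s <= S -> 0 <= t <= S -> `|s - t| <= r -> `|x s - x t| <= e).
  near=> z; split; near: z; first exact: nbhs_right_gt.
  exact: h.
by exists r => // s t hs ht; apply: hr => //; rewrite /= in_itv.
Unshelve. all: by end_near. Qed.

End uniform_continuity.

Section step_paths.
Context {R : realType} {d : nat}.
Variable S : R.
Implicit Types M k L r e : R.
Hypothesis S0 : 0 < S.

Definition step_index (n : nat) (t : R) : nat := Num.truncn (t * n.+1%:R / S).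

Lemma step_index_le n t : 0 <= t <= S -> (step_index n t <= n.+1)%N.
Proof.
move=> /andP[t0 tS]; rewrite /step_index -ltnS truncn_lt_nat; last first.
  by rewrite divr_ge0 ?mulr_ge0// ltW.
by rewrite ltr_pdivrMr// mulrC (le_lt_trans (ler_wpM2l _ tS))// ltr_pM2r// ltr_nat.
Qed.

Lemma step_index_bounds n t : 0 <= t ->
  S * (step_index n t)%:R / n.+1%:R <= t < S * (step_index n t).+1%:R / n.+1%:R.
Proof.
move=> t0; have h : 0 <= t * n.+1%:R / S by rewrite divr_ge0 ?mulr_ge0// ltW.
have /andP[h1 h2] := truncn_itv h; apply/andP; split.
  by rewrite ler_pdivrMr// mulrC -ler_pdivlMr.
by rewrite ltr_pdivlMr// [ltRHS]mulrC -ltr_pdivrMr.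
Qed.

Lemma step_time_bounds n (k : nat) : (k <= n.+1)%N -> 0 <= S * k%:R / n.+1%:R <= S.
Proof.
move=> kn; apply/andP; split; first by rewrite divr_ge0// mulr_ge0// ltW.
by rewrite ler_pdivrMr// ler_wpM2l ?ler_nat// ltW.
Qed.

Lemma step_time_close n t : 0 <= t ->
  `|S * (step_index n t)%:R / n.+1%:R - t| <= S / n.+1%:R.
Proof.
move=> /(step_index_bounds n)/andP[h1 h2].
rewrite distrC ger0_norm ?subr_ge0// lerBlDl (le_trans (ltW h2))//.
by rewrite -mulrDl -[X in _ + X]mulr1 -mulrDr -natr1.
Qed.

Definition step_path n (x : R -> 'rV[R]_d) t := x (S * (step_index n t)%:R / n.+1%:R).

Lemma step_path_cvg (x : R -> 'rV[R]_d) e : uniformly_continuous_upto S x -> 0 < e ->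
  \forall n \near \oo, forall t, 0 <= t <= S -> `|step_path n x t - x t| <= e.
Proof.
move=> ucx e0; have [r r0 hr] := ucx e e0.
near=> n; move=> t /andP[t0 tS]; apply: hr; rewrite ?t0//.
  by apply: step_time_bounds; apply: step_index_le; rewrite t0.
apply: le_trans (step_time_close _ t0) _.
rewrite -ler_pdivlMl// mulrC; apply: ltW; near: n.
have rS : 0 < r / S by rewrite divr_gt0.
exact: (near_infty_natSinv_lt (PosNum rS)).
Unshelve. all: by end_near. Qed.

(** Arguments are arbitrary functions rather than elements of the path space: the step paths and
    Euler schemes fed to [h] are discontinuous. Only the values on [0, S] matter. *)
Definition lipschitz_functional k (h : (R -> 'rV[R]_d) -> 'rV[R]_d -> R) :=
  forall x x' v v' r, (forall t, 0 <= t <= S -> `|x t - x' t| <= r) ->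
    `|v - v'| <= r -> `|h x v - h x' v'| <= k * r.

Lemma lipschitz_functional_ext k h x x' v : lipschitz_functional k h ->
  (forall t, 0 <= t <= S -> x t = x' t) -> h x v = h x' v.
Proof.
move=> hk xx'; apply/eqP; rewrite -subr_eq0 -normr_le0.
rewrite -[leRHS](mulr0 k); apply: hk; last by rewrite subrr normr0.
by move=> t tS; rewrite xx'// subrr normr0.
Qed.

Lemma lipschitz_finitely_continuous (J : finType) k h L
    (x : (J -> R) -> R -> 'rV[R]_d) (v : (J -> R) -> 'rV[R]_d) :
  lipschitz_functional k h -> 0 <= k ->
  (forall y y' r, 0 <= r -> (forall j, `|y j - y' j| <= r) ->
    (forall t, 0 <= t <= S -> `|x y t - x y' t| <= L * r) /\
    `|v y - v y'| <= L * r) -> 0 <= L ->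
  finitely_continuous (fun y => h (x y) (v y)).
Proof.
move=> hk k0 xv L0 y e e0.
have r0 : 0 < e / (k * L + 1) by rewrite divr_gt0// ltr_wpDl// mulr_ge0.
exists (e / (k * L + 1)) => // y' yy'; have [h1 h2] := xv _ _ _ (ltW r0) yy'.
apply: le_trans (hk _ _ _ _ _ h1 h2) _.
rewrite !mulrA ler_pdivrMr ?ltr_wpDl ?mulr_ge0//.
by rewrite mulrC ler_pM2l// lerDl.
Qed.

End step_paths.

Section path_functionals.
Context {R : realType} {disp : measure_display} {Omega : measurableType disp}.
Variable P : probability Omega R.
Context {d : nat}.
Variable S : R.
Implicit Types M k L r e : R.
Hypothesis S0 : 0 < S.

Lemma step_path_functional_cvg k h (x : R -> 'rV[R]_d) v :
  lipschitz_functional S k h -> 0 <= k -> uniformly_continuous_upto S x ->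
  h (step_path S n x) v @[n --> \oo] --> h x v.
Proof.
move=> hk k0 ucx; apply/cvgrPdist_le => e e0.
have e'0 : 0 < e / (k + 1) by rewrite divr_gt0// ltr_wpDl.
near=> n; apply: le_trans (hk _ _ _ _ (e / (k + 1)) _ _) _.
- move=> t tS; rewrite distrC; move: t tS; near: n.
  exact: step_path_cvg.
- by rewrite subrr normr0 ltW.
- by rewrite mulrA ler_pdivrMr ?ltr_wpDl// mulrC ler_pM2l// lerDl.
Unshelve. all: by end_near. Qed.

Lemma bounded_rv_step_path n M k h (X : R -> Omega -> 'rV[R]_d) (V : Omega -> 'rV[R]_d) :
  lipschitz_functional S k h -> 0 <= k -> (forall x v, `|h x v| <= M) ->
  (forall t, 0 <= t <= S -> random_vector (X t)) -> random_vector V ->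
  bounded_rv M (fun w => h (step_path S n (X ^~ w)) (V w)).
Proof.
move=> hk k0 bh rX rV.
(* There are [n.+2] nodes, because the step index takes the value [n.+1] at t = S. *)
pose J := ('I_n.+2 * 'I_d + 'I_d)%type.
pose VV (w : Omega) (j : J) := match j with
  | inl (m, i) => X (S * m%:R / n.+1%:R) w ord0 i | inr i => V w ord0 i end.
pose xx (y : J -> R) t : 'rV[R]_d := \row_i y (inl (inord (step_index S n t), i)).
pose vv (y : J -> R) : 'rV[R]_d := \row_i y (inr i).
have -> : (fun w => h (step_path S n (X ^~ w)) (V w)) =
          (fun w => (fun y => h (xx y) (vv y)) (VV w)).
  apply/funext => w /=; rewrite (_ : vv (VV w) = V w); last first.
    by apply/rowP => i; rewrite !mxE.
  apply: (lipschitz_functional_ext _ hk) => t tS; apply/rowP => i.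
  by rewrite mxE /VV /step_path inordK// ltnS step_index_le.
apply: (@bounded_rv_finitely_continuous _ _ _ P J M VV (fun y => h (xx y) (vv y))).
- move=> [[m i]|i] /=; last exact: rV.
  by apply: rX; apply: step_time_bounds => //; rewrite -ltnS.
- apply: (lipschitz_finitely_continuous hk k0 (L := 1)) => // y y' r r0 yy'.
  have sub (z z' : 'rV[R]_d) : (forall i, `|z ord0 i - z' ord0 i| <= r) -> `|z - z'| <= r.
    by move=> zz'; apply/rV_norm_le => // i; rewrite !mxE.
  rewrite mul1r; split => [t tS|]; apply: sub => i; rewrite !mxE; exact: yy'.
- by move=> y; exact: bh.
Qed.

(** The functional sees uncountably many times; by uniform continuity of the path it is the limit of
    its values on step paths, which see finitely many. *)
Lemma bounded_rv_path_functional M k h (X : R -> Omega -> 'rV[R]_d) (V : Omega -> 'rV[R]_d) :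
  lipschitz_functional S k h -> 0 <= k -> (forall x v, `|h x v| <= M) ->
  (forall t, 0 <= t <= S -> random_vector (X t)) ->
  (forall w, uniformly_continuous_upto S (X ^~ w)) -> random_vector V ->
  bounded_rv M (fun w => h (X ^~ w) (V w)).
Proof.
move=> hk k0 bh rX cX rV.
have [||h' _ //] := @bounded_convergence _ _ _ P M
  (fun n w => h (step_path S n (X ^~ w)) (V w)) (fun w => h (X ^~ w) (V w)).
- by move=> n; exact: (bounded_rv_step_path n hk k0 bh rX rV).
- by move=> w; exact: (step_path_functional_cvg hk k0 (cX w)).
Qed.

End path_functionals.

Section oscillation.
Context {R : realType} {d : nat}.
Implicit Types (S delta eta r : R) (x : R -> 'rV[R]_d).

(** The modulus of continuity at scale [delta], in units of [eta] and truncated at 1. A value below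
    1 bounds the modulus by [eta], and on the complementary event the value dominates the indicator;
    truncation keeps the functional bounded. *)
Definition oscillation S delta eta x : R :=
  sup [set r | exists s t, [/\ 0 <= s <= S, 0 <= t <= S, `|s - t| <= delta &
    r = Num.min 1 (`|x s - x t| / eta)]].

Section properties.
Variables (S delta eta : R).
Hypotheses (S0 : 0 <= S) (delta0 : 0 <= delta) (eta0 : 0 < eta).

Lemma le_oscillation x s t : 0 <= s <= S -> 0 <= t <= S -> `|s - t| <= delta ->
  Num.min 1 (`|x s - x t| / eta) <= oscillation S delta eta x.
Proof.
move=> sS tS st; apply: ub_le_sup; last by exists s, t.
by exists 1 => _ [? [? [_ _ _ ->]]]; rewrite ge_min lexx.
Qed.

Lemma oscillation_le x b :
  (forall s t, 0 <= s <= S -> 0 <= t <= S -> `|s - t| <= delta ->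
    Num.min 1 (`|x s - x t| / eta) <= b) -> oscillation S delta eta x <= b.
Proof.
move=> h; apply: ge_sup.
  exists (Num.min 1 (`|x 0 - x 0| / eta)), 0, 0.
  by split; rewrite ?lexx ?S0// subrr normr0.
by move=> _ [s [t [? ? ? ->]]]; exact: h.
Qed.

Lemma oscillation_ge0 x : 0 <= oscillation S delta eta x.
Proof.
apply: le_trans (@le_oscillation x 0 0 _ _ _); rewrite ?lexx ?S0 ?subrr ?normr0//.
by rewrite mul0r le_min ler01 lexx.
Qed.

Lemma oscillation_le1 x : oscillation S delta eta x <= 1.
Proof. by apply: oscillation_le => *; rewrite ge_min lexx. Qed.

Lemma oscillation_lt1 x s t : oscillation S delta eta x < 1 ->
  0 <= s <= S -> 0 <= t <= S -> `|s - t| <= delta -> `|x s - x t| <= eta.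
Proof.
move=> o1 sS tS st; have := le_lt_trans (le_oscillation x sS tS st) o1.
by rewrite gt_min ltxx/= ltr_pdivrMr// mul1r => /ltW.
Qed.

Lemma oscillation_shift x y : (forall t, 0 <= t <= S -> y t = x t - x 0) ->
  oscillation S delta eta y = oscillation S delta eta x.
Proof.
move=> yE; congr sup; apply/seteqP; split => _ [s [t [sS tS st ->]]]; exists s, t; split => //;
  by rewrite !yE// opprB addrA subrK.
Qed.

(** The factor 2 counts the two endpoints of an increment. *)
Lemma lipschitz_oscillation :
  lipschitz_functional S (2 / eta) (fun x (_ : 'rV[R]_d) => oscillation S delta eta x).
Proof.
have main x x' r : (forall t, 0 <= t <= S -> `|x t - x' t| <= r) ->
    oscillation S delta eta x <= oscillation S delta eta x' + 2 / eta * r.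
  move=> xx'; apply: oscillation_le => s t sS tS st.
  have := le_oscillation x' sS tS st; rewrite -(lerD2r (2 / eta * r)); apply: le_trans.
  have r0 : 0 <= r by apply: le_trans (xx' 0 _); rewrite ?lexx.
  have e0 : 0 <= 2 / eta * r by rewrite mulr_ge0// divr_ge0// ltW.
  have : `|x s - x t| / eta <= `|x' s - x' t| / eta + 2 / eta * r.
    rewrite -[X in _ <= _ + X]mulrA [eta^-1 * r]mulrC mulrA -mulrDl ler_pM2r ?invr_gt0//.
    rewrite (_ : x s - x t = x' s - x' t + ((x s - x' s) - (x t - x' t))); last first.
      by apply/rowP => i; rewrite !mxE; ring.
    rewrite (le_trans (ler_normD _ _))// lerD2l (le_trans (ler_normB _ _))//.
    by rewrite mulr2n mulrDl mul1r lerD// xx'.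
  have [_ _|_] := leP 1 (`|x' s - x' t| / eta); first by rewrite ge_min lerDl e0.
  by rewrite ge_min => ->; rewrite orbT.
move=> x x' _ _ r xx' _; rewrite ler_norml.
have h1 := main _ _ _ xx'.
have h2 : oscillation S delta eta x' <= oscillation S delta eta x + 2 / eta * r.
  by apply: main => t tS; rewrite distrC xx'.
by apply/andP; split; lra.
Qed.

End properties.
End oscillation.

Section brownian_oscillation.
Context {R : realType} {disp : measure_display} {Omega : measurableType disp}.
Variable P : probability Omega R.
Context {d : nat}.
Variable B : R -> Omega -> 'rV[R]_d.
Hypothesis B_brownian : brownian_motion P B.
Implicit Types (S delta eta g : R).

Definition rescale g t w : 'rV[R]_d := (Num.sqrt g)^-1 *: B (g * t) w.

Let B_rv t : 0 <= t -> random_vector (B t).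
Proof. by case: B_brownian => + _ _ _ _ => /(_ t). Qed.

Lemma uniformly_continuous_brownian S w : uniformly_continuous_upto S (B ^~ w).
Proof. by apply: heine; case: B_brownian. Qed.

Lemma uniformly_continuous_rescale S g w : 0 < g ->
  uniformly_continuous_upto S (rescale g ^~ w).
Proof.
move=> g0 e e0; have sg : 0 < Num.sqrt g by rewrite sqrtr_gt0.
have [|r r0 hr] := @uniformly_continuous_brownian (g * S) w (Num.sqrt g * e).
  by rewrite mulr_gt0.
exists (r / g); first by rewrite divr_gt0.
move=> s t /andP[s0 sS] /andP[t0 tS] st.
rewrite /rescale -scalerBr normrZ ger0_norm ?invr_ge0 ?sqrtr_ge0// ler_pdivrMl//.
apply: hr.
- by rewrite mulr_ge0 ?(ltW g0)//= ler_pM2l.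
- by rewrite mulr_ge0 ?(ltW g0)//= ler_pM2l.
by rewrite -mulrBr normrM gtr0_norm// mulrC -ler_pdivlMr.
Qed.

Lemma random_vector_rescale g t : 0 < g -> 0 <= t -> random_vector (rescale g t).
Proof.
move=> g0 t0 i; rewrite (_ : (fun w => _) = (fun w => (Num.sqrt g)^-1 * B (g * t) w ord0 i)).
  by apply: measurable_funM => //; apply: B_rv; rewrite mulr_ge0// ltW.
by apply/funext => w; rewrite !mxE.
Qed.

Lemma telescope_upto (N k : nat) (u : nat -> R) : (k <= N)%N ->
  \sum_(j < N | (j < k)%N) (u j.+1 - u j) = u k - u 0%N.
Proof.
move=> kN; rewrite -(big_ord_widen N (fun j => u j.+1 - u j) kN).
by rewrite -(big_mkord xpredT (fun j => u j.+1 - u j)) telescope_sumr.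
Qed.

Section horizon.
Variables (S eta : R).
Hypotheses (S0 : 0 < S) (eta0 : 0 < eta).

Let bounded_oscillation delta (x : R -> 'rV[R]_d) : 0 <= delta -> `|oscillation S delta eta x| <= 1.
Proof.
move=> delta0; rewrite ger0_norm; last by apply: oscillation_ge0 => //; exact: ltW.
by apply: oscillation_le1 => //; exact: ltW.
Qed.

Lemma bounded_rv_oscillation delta (X : R -> Omega -> 'rV[R]_d) : 0 <= delta ->
  (forall t, 0 <= t <= S -> random_vector (X t)) ->
  (forall w, uniformly_continuous_upto S (X ^~ w)) ->
  bounded_rv 1 (fun w => oscillation S delta eta (X ^~ w)).
Proof.
move=> delta0 rX cX.
apply: (@bounded_rv_path_functional _ _ _ P d S S0 1 (2 / eta)
  (fun x _ => oscillation S delta eta x) X (fun=> 0)) => //.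
- by apply: lipschitz_oscillation => //; exact: ltW.
- by rewrite divr_ge0// ltW.
- by move=> x _; exact: bounded_oscillation.
Qed.

(** Brownian scaling is needed only for finitely many increments at a time: on step paths the
    oscillation is a function of the grid increments, and the mesh is refined by bounded
    convergence. *)
Lemma oscillation_rescale_law delta g : 0 <= delta -> 0 < g ->
  \int[P]_w oscillation S delta eta (rescale g ^~ w) =
  \int[P]_w oscillation S delta eta (B ^~ w).
Proof.
move=> delta0 g0.
have lipO := lipschitz_oscillation (d := d) (ltW S0) delta0 eta0.
have e20 : 0 <= 2 / eta by rewrite divr_ge0// ltW.
have cvgO (X : R -> Omega -> 'rV[R]_d) :
    (forall t, 0 <= t <= S -> random_vector (X t)) ->
    (forall w, uniformly_continuous_upto S (X ^~ w)) ->
    \int[P]_w oscillation S delta eta (step_path S n (X ^~ w)) @[n --> \oo] -->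
    \int[P]_w oscillation S delta eta (X ^~ w).
  move=> rX cX; have [n|w|_ //] := @bounded_convergence _ _ _ P 1
    (fun n w => oscillation S delta eta (step_path S n (X ^~ w)))
    (fun w => oscillation S delta eta (X ^~ w)).
    apply: (bounded_rv_step_path P S0 n (V := fun=> 0) lipO e20 _ rX) => // x v.
    exact: bounded_oscillation.
  exact: (step_path_functional_cvg (v := 0) S0 lipO e20 (cX w)).
have cW := cvgO (rescale g) (fun t tS => random_vector_rescale g0 (proj1 (andP tS)))
  (fun w => uniformly_continuous_rescale _ w g0).
have cB := cvgO B (fun t tS => B_rv (proj1 (andP tS)))
  (fun w => uniformly_continuous_brownian _ w).
suff E n : \int[P]_w oscillation S delta eta (step_path S n (rescale g ^~ w)) =
    \int[P]_w oscillation S delta eta (step_path S n (B ^~ w)).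
  move: cW; rewrite (funext E) => cW.
  exact: (cvg_unique (@Rhausdorff R) cW cB).
pose u k : R := S * k%:R / n.+1%:R.
(* The step path is rebuilt from its increments, starting at 0; [oscillation_shift] makes the true
   starting point irrelevant. *)
pose xx (y : 'I_n.+1 * 'I_d -> R) t : 'rV[R]_d :=
  \row_i \sum_(j < n.+1 | (j < step_index S n t)%N) y (j, i).
have step0 (x : R -> 'rV[R]_d) : step_path S n x 0 = x 0.
  by rewrite /step_path /step_index !mul0r truncn0 mulr0 mul0r.
have xxE (x : R -> 'rV[R]_d) a :
    (forall y : 'I_n.+1 * 'I_d -> R, (forall (j : 'I_n.+1) i, y (j, i) = a * (x (u j.+1) - x (u j)) ord0 i) ->
    oscillation S delta eta (xx y) = oscillation S delta eta (step_path S n (fun t => a *: x t))).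
  move=> y yE; apply: oscillation_shift => // t tS.
  rewrite step0; apply/rowP => i; rewrite mxE.
  under eq_bigr do rewrite yE.
  rewrite -mulr_sumr.
  under eq_bigr do rewrite 2!mxE.
  rewrite (@telescope_upto n.+1 _ (fun j => x (u j) ord0 i)) ?step_index_le//.
  by rewrite !mxE /u mulr0 mul0r mulrBr.
transitivity (\int[P]_w oscillation S delta eta
    (xx (fun ki => (Num.sqrt g)^-1 * (B (g * u ki.1.+1) w - B (g * u ki.1) w) ord0 ki.2))).
  apply: eq_Rintegral => w _.
  by rewrite (@xxE (fun t => B (g * t) w) (Num.sqrt g)^-1).
transitivity (\int[P]_w oscillation S delta eta
    (xx (fun ki => (B (u ki.1.+1) w - B (u ki.1) w) ord0 ki.2))); last first.
  apply: eq_Rintegral => w _.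
  rewrite (@xxE (fun t => B t w) 1) => [|j i]; last by rewrite mul1r.
  by congr (oscillation _ _ _ (step_path _ _ _)); apply/funext => t; rewrite scale1r.
have uS k : u k < u k.+1.
  by rewrite /u ltr_pM2r ?invr_gt0// ltr_pM2l// ltr_nat.
apply: (scaled_brownian_increments_law (s := fun k => g * u k) (s' := u) (a := fun=> (Num.sqrt g)^-1)
  (M := 1) (H := fun y => oscillation S delta eta (xx y)) B_brownian).
- by rewrite /u mulr0 mul0r mulr0.
- by move=> k; rewrite ltr_pM2l.
- by rewrite /u mulr0 mul0r.
- by move=> k; rewrite invr_gt0 sqrtr_gt0.
- by move=> k; rewrite -mulrBr mulrA exprVn sqr_sqrtr ?ltW// mulVf ?mul1r// gt_eqF.
- apply: (lipschitz_finitely_continuous (v := fun=> 0) lipO e20 (L := n.+1%:R)) => // y y' r r0 yy'.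
  split=> [t tS|]; last by rewrite subrr normr0 mulr_ge0.
  apply/rV_norm_le => [|i]; first by rewrite mulr_ge0.
  rewrite !mxE -sumrB; apply: le_trans (ler_norm_sum _ _ _) _.
  apply: (@le_trans _ _ (\sum_(j < n.+1) r)).
    rewrite big_mkcond/=; apply: ler_sum => j _; case: ifP => // _; exact: yy'.
  by rewrite sumr_const card_ord mulr_natl.
- by move=> y; exact: bounded_oscillation.
Qed.

(** For B the oscillation tends to 0 on each path by uniform continuity, hence in mean, and it is
    monotone in [delta]. Equality of laws makes the same [delta0] work for every [g]. *)
Lemma oscillation_expectation_small e : 0 < e -> exists2 delta0, 0 < delta0 &
  forall delta, 0 <= delta <= delta0 ->
  \int[P]_w oscillation S delta eta (B ^~ w) <= e /\
  forall g, 0 < g -> \int[P]_w oscillation S delta eta (rescale g ^~ w) <= e.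
Proof.
move=> e0.
have [n|w|_] := @bounded_convergence _ _ _ P 1
  (fun n w => oscillation S n.+1%:R^-1 eta (B ^~ w)) (fun w => 0).
- apply: bounded_rv_oscillation => // [t /andP[t0 _]|w]; first exact: B_rv.
  exact: uniformly_continuous_brownian.
- apply/cvgrPdist_le => e' e'0.
  have [|r r0 hr] := @uniformly_continuous_brownian S w (e' * eta); first by rewrite mulr_gt0.
  near=> n; rewrite sub0r normrN ger0_norm; last by apply: oscillation_ge0 => //; exact: ltW.
  apply: oscillation_le => // [|s t sS tS st]; first exact: ltW.
  rewrite ge_min ler_pdivrMr// hr ?orbT// (le_trans st)//.
  by apply: ltW; near: n; exact: (near_infty_natSinv_lt (PosNum r0)).
rewrite mean_cst => /cvgrPdist_le/(_ e e0)[n _ /(_ n (leqnn n))].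
rewrite /= sub0r normrN => /(le_trans (ler_norm _)) hn.
exists n.+1%:R^-1; first by rewrite invr_gt0 ltr0n.
move=> delta /andP[delta0 dn].
have hB : \int[P]_w oscillation S delta eta (B ^~ w) <= e.
  apply: le_trans hn; apply: (@ae_le_expectation _ _ _ P 1 1).
  - apply: bounded_rv_oscillation => // [t /andP[t0 _]|w]; first exact: B_rv.
    exact: uniformly_continuous_brownian.
  - apply: bounded_rv_oscillation => // [t /andP[t0 _]|w]; first exact: B_rv.
    exact: uniformly_continuous_brownian.
  apply: aeW => w; apply: oscillation_le => // [|s t sS tS st]; first exact: ltW.
  by apply: le_oscillation => //; exact: le_trans dn.
split; first exact: hB.
by move=> g g0; rewrite (oscillation_rescale_law delta0 g0); exact: hB.
Unshelve. all: by end_near. Qed.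

End horizon.
End brownian_oscillation.

(** * Pathwise estimates *)

Section euler_scheme.
Context {R : realType} {d : nat}.
Implicit Types (x y q : 'rV[R]_d).
Variables (F : 'rV[R]_d -> 'rV[R]_d) (MF L : R).
Hypothesis F_bound : forall x, `|F x| <= MF.
Hypothesis F_lip : forall x y, `|F x - F y| <= L * `|x - y|.
Hypothesis L0 : 0 <= L.

(** The only property used of A s t = int_s^t F(Q_u) du. Stating it abstractly lets the time-changed
    Langevin drift and the overdamped drift share the same estimates. *)
Definition drift_control T (Q : R -> 'rV[R]_d) (A : R -> R -> 'rV[R]_d) :=
  forall s t y e, 0 <= s -> s <= t -> t <= T ->
    (forall u, s <= u <= t -> `|F (Q u) - y| <= e) ->
    `|A s t - (t - s) *: y| <= e * (t - s).

Fixpoint euler (h c : R) q (xi : nat -> 'rV[R]_d) (k : nat) : 'rV[R]_d :=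
  if k is k'.+1 then
    euler h c q xi k' + h *: F (euler h c q xi k') + c *: xi k'
  else q.

Lemma drift_bound T Q A s t : drift_control T Q A -> 0 <= s -> s <= t -> t <= T ->
  `|A s t| <= MF * (t - s).
Proof.
move=> HA s0 st tT; have := HA s t 0 MF s0 st tT.
by rewrite scaler0 subr0; apply => u _; rewrite subr0.
Qed.

(** The cap at [n] also applies at t = T, so a scheme read at this index never uses the increment
    over the last grid interval; this leaves that interval free for the momentum. *)
Definition frozen_index (T : R) (n : nat) (t : R) := minn (step_index T n t) n.

Lemma frozen_index_bounds T n t : 0 < T -> 0 <= t <= T ->
  T * (frozen_index T n t)%:R / n.+1%:R <= t <= T * (frozen_index T n t).+1%:R / n.+1%:R.
Proof.
move=> T0 /andP[t0 tT]; have /andP[h1 h2] := step_index_bounds T0 n t0.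
rewrite /frozen_index; case: (leqP (step_index T n t) n) => [_|nk]; first by rewrite h1 ltW.
rewrite mulfK ?gt_eqF// tT andbT (le_trans _ h1)//.
by rewrite ler_pM2r ?invr_gt0// ler_pM2l// ler_nat ltnW.
Qed.

(** A discrete Gronwall argument for [Y], which satisfies the integral equation exactly while the
    drift is evaluated at the nearby [Q]. For Langevin [Y] is Q + P / g; for the overdamped equation
    [Y] is [Q] and [rho] is 0. *)
Lemma euler_close T (n : nat) c rho eta q (Q Y W : R -> 'rV[R]_d) A :
  0 < T -> 0 <= c -> 0 <= rho ->
  drift_control T Q A ->
  (forall s t, 0 <= s -> s <= t -> t <= T -> Y t - Y s = A s t + c *: (W t - W s)) ->
  (forall t, 0 <= t <= T -> `|Y t - Q t| <= rho) -> Q 0 = q ->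
  (forall s t, 0 <= s <= T -> 0 <= t <= T -> `|s - t| <= T / n.+1%:R -> `|W s - W t| <= eta) ->
  forall t, 0 <= t <= T ->
  `|Q t - euler (T / n.+1%:R) c q
      (fun k => W (T * k.+1%:R / n.+1%:R) - W (T * k%:R / n.+1%:R)) (frozen_index T n t)|
  <= 2 * (rho + (T / n.+1%:R * MF + c * eta)) * expR (L * T).
Proof.
move=> T0 c0 rho0 HA HY HYQ Q0 HW.
set h := T / n.+1%:R; pose tau (k : nat) : R := T * k%:R / n.+1%:R.
set X := euler _ _ _ _.
have h0 : 0 < h by rewrite divr_gt0.
have tauS k : tau k.+1 = tau k + h.
  by rewrite /tau /h -natr1 mulrDr mulr1 mulrDl.
have tau_in k : (k <= n.+1)%N -> 0 <= tau k <= T by apply: step_time_bounds.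
have MF0 : 0 <= MF by apply: le_trans (F_bound q).
have eta0 : 0 <= eta.
  have z : 0 <= (0 : R) <= T by rewrite lexx ltW.
  have z' : `|0 - 0 : R| <= h by rewrite subrr normr0 ltW.
  exact: le_trans (normr_ge0 _) (HW 0 0 z z z').
set kap := rho + (h * MF + c * eta).
have kap0 : 0 <= kap by rewrite addr_ge0// addr_ge0// mulr_ge0// ltW.
have local k u : (k <= n)%N -> tau k <= u <= tau k.+1 -> `|Q u - Y (tau k)| <= kap.
  move=> kn /andP[ku uk].
  have /andP[k0 kT] := tau_in k (leqW kn); have /andP[_ k1T] := tau_in k.+1 kn.
  have uT := le_trans uk k1T; have u0 := le_trans k0 ku.
  rewrite (_ : Q u - Y (tau k) = - (Y u - Q u) + (Y u - Y (tau k))); last first.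
    by apply/rowP => i; rewrite !mxE; ring.
  apply: le_trans (ler_normD _ _) _; rewrite normrN lerD//; first by apply: HYQ; rewrite u0.
  have uh : u - tau k <= h by rewrite lerBlDl -tauS.
  rewrite HY//; apply: le_trans (ler_normD _ _) _; rewrite lerD//.
    apply: le_trans (drift_bound HA k0 ku uT) _.
    by rewrite mulrC ler_wpM2r.
  rewrite normrZ ger0_norm// ler_wpM2l// HW// ?k0 ?u0//.
  by rewrite ger0_norm ?subr_ge0.
(* Adding [kap] to the error makes the recursion homogeneous, with factor 1 + L h; the initial error
   is at most [rho], hence at most [kap]. *)
have main k : (k <= n)%N -> `|Y (tau k) - X k| + kap <= 2 * kap * (1 + L * h) ^+ k.
  elim: k => [_|k IH kn].
    rewrite expr0 mulr1 mulr2n mulrDl mul1r lerD2r /tau mulr0 mul0r /X/= -Q0.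
    apply: le_trans (HYQ 0 _) _; first by rewrite lexx ltW.
    by rewrite lerDl addr_ge0// mulr_ge0// ltW.
  have {}IH := IH (ltnW kn).
  have /andP[k0 kT] := tau_in k (leqW (ltnW kn)); have /andP[_ k1T] := tau_in k.+1 (leqW kn).
  have kk : tau k <= tau k.+1 by rewrite tauS lerDl ltW.
  set e := `|Y (tau k) - X k| in IH *.
  have HAk : `|A (tau k) (tau k.+1) - h *: F (X k)| <= L * (e + kap) * h.
    have := HA (tau k) (tau k.+1) (F (X k)) (L * (e + kap)) k0 kk k1T.
    rewrite tauS [tau k + h - _]addrC addKr -tauS; apply => u ku.
    apply: le_trans (F_lip _ _) _; rewrite ler_wpM2l//.
    rewrite (_ : Q u - X k = (Y (tau k) - X k) + (Q u - Y (tau k))); last first.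
      by apply/rowP => i; rewrite !mxE; ring.
    by apply: le_trans (ler_normD _ _) _; rewrite lerD// local// ltnW.
  apply: (@le_trans _ _ ((1 + L * h) * (e + kap))); last first.
    rewrite exprS [leRHS]mulrCA; apply: ler_wpM2l; last exact: IH.
    by rewrite addr_ge0// mulr_ge0// ltW.
  rewrite (_ : Y (tau k.+1) - X k.+1 =
     (Y (tau k) - X k) + (A (tau k) (tau k.+1) - h *: F (X k))); last first.
    rewrite -[Y (tau k.+1)](subrK (Y (tau k))) HY//.
    by apply/rowP => i; rewrite /X/= -/X !mxE; ring.
  rewrite mulrDl mul1r (_ : L * h * (e + kap) = L * (e + kap) * h); last by ring.
  by rewrite [leRHS]addrAC lerD2r (le_trans (ler_normD _ _))// lerD2l.
move=> t tT; have /andP[ft tf] := frozen_index_bounds n T0 tT.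
set k := frozen_index T n t in ft tf *.
have kn : (k <= n)%N by rewrite geq_minr.
rewrite (_ : Q t - X k = (Y (tau k) - X k) + (Q t - Y (tau k))); last first.
  by apply/rowP => i; rewrite !mxE; ring.
apply: le_trans (ler_normD _ _) _.
apply: (@le_trans _ _ (`|Y (tau k) - X k| + kap)).
  by rewrite lerD2l local// ft.
apply: le_trans (main k kn) _; rewrite ler_wpM2l ?mulr_ge0//.
have Lh : 0 <= L * h by rewrite mulr_ge0// ltW.
apply: (@le_trans _ _ (expR (L * h) ^+ k)).
  by rewrite lerXn2r ?nnegrE ?addr_ge0 ?expR_ge0// expR_ge1Dx.
rewrite -expRM_natl ler_expR mulrCA ler_wpM2l// /h mulrCA ler_piMr ?(ltW T0)//.
by rewrite ler_pdivrMr// mul1r ler_nat leqW.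
Qed.

(** This serves only the continuity of the scheme in its finitely many increments, so [K] may grow
    with the number of steps. *)
Lemma euler_lipschitz h c q k : 0 <= h -> 0 <= c -> exists2 K, 0 <= K &
  forall xi xi' r, 0 <= r -> (forall j, (j < k)%N -> `|xi j - xi' j| <= r) ->
    forall j, (j <= k)%N -> `|euler h c q xi j - euler h c q xi' j| <= K * r.
Proof.
move=> h0 c0; elim: k => [|k [K K0 IH]].
  by exists 0 => // xi xi' r r0 _ [|//] _; rewrite subrr normr0 mul0r.
exists ((1 + h * L) * K + c).
  by rewrite addr_ge0// mulr_ge0// addr_ge0// mulr_ge0.
move=> xi xi' r r0 xx j; have {}IH := IH xi xi' r r0 (fun j jk => xx j (ltnW jk)).
have Kr : K * r <= ((1 + h * L) * K + c) * r.
  rewrite ler_wpM2r// mulrDl mul1r -addrA lerDl addr_ge0// !mulr_ge0//.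
rewrite leq_eqVlt => /predU1P[->|jk]; last by rewrite (le_trans (IH j jk)).
rewrite /=; set x := euler _ _ _ _ _; set x' := euler _ _ _ _ _.
rewrite (_ : _ - _ = (x - x') + h *: (F x - F x') + c *: (xi k - xi' k)); last first.
  by apply/rowP => i; rewrite !mxE; ring.
rewrite mulrDl mulrDl mul1r mulrDl.
have xxK : `|x - x'| <= K * r by exact: IH.
apply: le_trans (ler_normD _ _) _; rewrite lerD//; last first.
  by rewrite normrZ ger0_norm// ler_wpM2l// xx.
apply: le_trans (ler_normD _ _) _; rewrite lerD//.
rewrite normrZ ger0_norm// -!mulrA ler_wpM2l// (le_trans (F_lip _ _))//.
by rewrite ler_wpM2l.
Qed.

End euler_scheme.

Section last_exit.
Context {R : realType}.
Variables (T a g MF delta nu K : R).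

(* If u exceeds a, look at a window on which u stays above a/2 and which starts
   below 3a/4: a short window has too little noise to climb by a/4, and on a long
   one the damping wins. *)
Lemma damped_le (u z : R -> R) (D : R -> R -> R) (X : R -> R -> R) :
  0 < a -> 0 < g -> 0 <= MF ->
  (forall e, 0 < e -> exists2 r, 0 < r & forall s t, 0 <= s <= T -> 0 <= t <= T ->
     `|s - t| <= r -> `|u s - u t| <= e) ->
  (forall s t, 0 <= s -> s <= t -> t <= T ->
     u t - u s = g * (D s t + X s t - (z t - z s))) ->
  (forall s t, 0 <= s -> s <= t -> t <= T -> D s t <= MF * (t - s)) ->
  (forall s t, 0 <= s -> s <= t -> t <= T -> (forall v, s <= v <= t -> a / 2 <= u v) ->
     a / 2 * g * (t - s) <= z t - z s) ->
  (forall s t, 0 <= s -> s <= t -> t <= T -> t - s <= delta -> X s t <= nu) ->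
  (forall s t, 0 <= s -> s <= t -> t <= T -> X s t <= K) ->
  u 0 <= a / 2 -> g * nu <= a / 4 -> 0 <= K -> 0 < delta ->
  K <= (g * a / 2 - MF) * delta ->
  forall t, 0 <= t <= T -> u t <= a.
Proof.
move=> a0 g0 MF0 cu uE DM zE Xnu XK u0 gnu K0 delta0 Kd t /andP[t0 tT].
rewrite leNgt; apply/negP => ut.
have a4 : 0 < a / 4 by rewrite divr_gt0.
have [r r0 hr] := cu (a / 4) a4.
pose E := [set v | 0 <= v <= t /\ u v <= a / 2].
have E0 : E 0 by split; rewrite ?lexx.
have ubE : has_sup E by split; [exists 0|exists t => v [/andP[]]].
have [v [/andP[v0 vt] uv] vr] := sup_adherent r0 ubE.
pose s := v + r.
have sE : sup E < s by rewrite -ltrBlDr.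
have st : s <= t.
  rewrite leNgt; apply/negP => ts.
  have : `|u t - u v| <= a / 4.
    apply: hr; rewrite ?t0 ?v0 ?(le_trans vt)//.
    by rewrite ger0_norm ?subr_ge0// lerBlDl ltW.
  rewrite ler_norml => /andP[_]; lra.
have s0 : 0 <= s by rewrite /s addr_ge0// ltW.
have above w : s <= w <= t -> a / 2 <= u w.
  move=> /andP[sw wt]; rewrite leNgt; apply/negP => uw.
  have : w <= sup E.
    apply: ub_le_sup; first by case: ubE.
    by split; [rewrite (le_trans s0)|exact: ltW].
  by rewrite leNgt (lt_le_trans sE).
have us : u s <= a / 2 + a / 4.
  have : `|u s - u v| <= a / 4.
    apply: hr; rewrite ?s0 ?v0 ?(le_trans st)// ?(le_trans vt)//.
    by rewrite /s addrC addKr ger0_norm// ltW.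
  rewrite ler_norml => /andP[_]; lra.
have main : a / 4 < g * (MF * (t - s) + X s t - a / 2 * g * (t - s)).
  apply: (@lt_le_trans _ _ (u t - u s)); first lra.
  rewrite uE// ler_pM2l// lerB// ?zE// lerD2r; exact: DM.
have ga : 0 <= g * a / 2 - MF.
  by rewrite -(pmulr_lge0 _ delta0) (le_trans K0).
have [tsd|tsd] := leP (t - s) delta.
  have X1 := Xnu s t s0 st tT tsd.
  have ts0 : 0 <= t - s by rewrite subr_ge0.
  have : g * (MF * (t - s) + X s t - a / 2 * g * (t - s)) <= g * nu.
    rewrite ler_pM2l//; have := mulr_ge0 ga ts0; lra.
  lra.
have X2 := XK s t s0 st tT.
have : g * (MF * (t - s) + X s t - a / 2 * g * (t - s)) <= 0.
  rewrite pmulr_rle0//.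
  have := ler_wpM2l ga (ltW tsd); lra.
lra.
Qed.

End last_exit.

Section langevin_estimates.
Context {R : realType} {d : nat}.
Variables (F : 'rV[R]_d -> 'rV[R]_d) (MF : R).
Hypothesis F_bound : forall x, `|F x| <= MF.
Variables (T g c : R) (P Q W : R -> 'rV[R]_d) (A : R -> R -> 'rV[R]_d).
Hypotheses (T0 : 0 < T) (g0 : 0 < g) (c0 : 0 <= c).
Hypothesis P_cont : uniformly_continuous_upto T P.
Hypothesis drift : drift_control F T Q A.
(** In slow time dQ = g P dt, so the friction term g^2 P dt is g dQ and dP = g (F(Q) dt + c dW -
    dQ). The equation for Q enters only through the one-sided bounds below. *)
Hypothesis balance : forall s t, 0 <= s -> s <= t -> t <= T ->
  P t - P s = g *: (A s t + c *: (W t - W s) - (Q t - Q s)).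
Hypothesis velocity : forall s t i b, 0 <= s -> s <= t -> t <= T ->
  (forall v, s <= v <= t -> b <= P v ord0 i) -> b * g * (t - s) <= (Q t - Q s) ord0 i.
Hypothesis velocity' : forall s t i b, 0 <= s -> s <= t -> t <= T ->
  (forall v, s <= v <= t -> P v ord0 i <= b) -> (Q t - Q s) ord0 i <= b * g * (t - s).

Implicit Types s t r o e a b delta nu eta K : R.

Let MF0 : 0 <= MF.
Proof. by apply: le_trans (F_bound 0). Qed.

(** For the sup norm it is enough to bound each coordinate from both sides; P, Q and their negatives
    all satisfy the hypotheses of [damped_le]. *)
Lemma momentum_bound a delta nu K :
  0 < a -> 0 < delta -> 0 <= K -> `|P 0| <= a / 2 -> g * nu <= a / 4 ->
  (forall s t, 0 <= s <= T -> 0 <= t <= T -> `|s - t| <= delta -> c * `|W s - W t| <= nu) ->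
  (forall s t, 0 <= s <= T -> 0 <= t <= T -> c * `|W s - W t| <= K) ->
  K <= (g * a / 2 - MF) * delta ->
  forall t, 0 <= t <= T -> `|P t| <= a.
Proof.
move=> a0 delta0 K0 P0 gnu Wnu WK Kd t tT.
have in_ s t' : 0 <= s -> s <= t' -> t' <= T -> 0 <= s <= T /\ 0 <= t' <= T.
  by move=> h1 h2 h3; rewrite h1 (le_trans h2 h3) (le_trans h1 h2) h3.
have noise s t' i : `|(c *: (W t' - W s)) ord0 i| <= c * `|W s - W t'|.
  by rewrite (le_trans (rV_coord_norm_le _ _))// normrZ ger0_norm// distrC.
have dr s t' i : 0 <= s -> s <= t' -> t' <= T -> `|A s t' ord0 i| <= MF * (t' - s).
  move=> h1 h2 h3; apply: le_trans (rV_coord_norm_le _ _) _.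
  exact: (drift_bound F_bound drift h1 h2 h3).
have cont i e : 0 < e -> exists2 r, 0 < r & forall s t, 0 <= s <= T -> 0 <= t <= T ->
     `|s - t| <= r -> `|P s ord0 i - P t ord0 i| <= e.
  move=> e0; have [r r0 hr] := P_cont e0; exists r => // s t' hs ht st.
  have := hr s t' hs ht st; apply: le_trans.
  by have := rV_coord_norm_le (P s - P t') i; rewrite !mxE.
apply/rV_norm_le => [|i]; first exact: ltW.
have Pi0 : `|P 0 ord0 i| <= a / 2 by rewrite (le_trans (rV_coord_norm_le _ _)).
rewrite ler_norml; apply/andP; split.
  rewrite lerNl.
  apply: (@damped_le R T a g MF delta nu K (fun t => - P t ord0 i) (fun t => - Q t ord0 i)
    (fun s t => - A s t ord0 i) (fun s t => - (c *: (W t - W s)) ord0 i)) => //.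
  - move=> e e0; have [r r0 hr] := cont i e e0; exists r => // s t' hs ht st.
    by rewrite -opprD normrN; exact: hr.
  - move=> s t' h1 h2 h3; have /(congr1 (fun v : 'rV[R]_d => v ord0 i)) := balance h1 h2 h3.
    rewrite !mxE => E; rewrite -opprD [LHS](congr1 -%R E); ring.
  - move=> s t' h1 h2 h3; apply: le_trans (dr _ _ i h1 h2 h3).
    by rewrite -normrN ler_norm.
  - move=> s t' h1 h2 h3 h.
    have : (Q t' - Q s) ord0 i <= - (a / 2) * g * (t' - s).
      by apply: velocity' => // v hv; rewrite lerNr; exact: h.
    by rewrite !mxE; lra.
  - move=> s t' h1 h2 h3 h; have [i1 i2] := in_ _ _ h1 h2 h3.
    apply: (le_trans (ler_norm _)); rewrite normrN (le_trans (noise _ _ _))//.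
    by apply: Wnu => //; rewrite distrC ger0_norm// subr_ge0.
  - move=> s t' h1 h2 h3; have [i1 i2] := in_ _ _ h1 h2 h3.
    apply: (le_trans (ler_norm _)); rewrite normrN (le_trans (noise _ _ _))//.
    exact: WK.
  - by rewrite (le_trans (ler_norm _))// normrN.
apply: (@damped_le R T a g MF delta nu K (fun t => P t ord0 i) (fun t => Q t ord0 i)
  (fun s t => A s t ord0 i) (fun s t => (c *: (W t - W s)) ord0 i)) => //.
- exact: cont.
- move=> s t' h1 h2 h3; have /(congr1 (fun v : 'rV[R]_d => v ord0 i)) := balance h1 h2 h3.
  by rewrite !mxE.
- by move=> s t' h1 h2 h3; apply: le_trans (dr _ _ i h1 h2 h3); rewrite ler_norm.
- move=> s t' h1 h2 h3 h.
  by have := velocity h1 h2 h3 h; rewrite !mxE.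
- move=> s t' h1 h2 h3 h; have [i1 i2] := in_ _ _ h1 h2 h3.
  apply: (le_trans (ler_norm _)); rewrite (le_trans (noise _ _ _))//.
  by apply: Wnu => //; rewrite distrC ger0_norm// subr_ge0.
- move=> s t' h1 h2 h3; have [i1 i2] := in_ _ _ h1 h2 h3.
  apply: (le_trans (ler_norm _)); rewrite (le_trans (noise _ _ _))//.
  exact: WK.
- by rewrite (le_trans (ler_norm _)).
Qed.

Lemma displacement_close s t v o : 0 <= s -> s <= t -> t <= T -> 0 <= o ->
  (forall r, s <= r <= t -> `|P r - v| <= o) ->
  `|(Q t - Q s) - (g * (t - s)) *: v| <= g * (t - s) * o.
Proof.
move=> s0 st tT o0 h; have ts : 0 <= t - s by rewrite subr_ge0.
apply/rV_norm_le => [|i]; first by rewrite !mulr_ge0// ltW.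
have h' r : s <= r <= t -> `|P r ord0 i - v ord0 i| <= o.
  move=> /h; apply: le_trans.
  by have := rV_coord_norm_le (P r - v) i; rewrite !mxE.
have h1 := @velocity s t i (v ord0 i - o) s0 st tT _.
have h2 := @velocity' s t i (v ord0 i + o) s0 st tT _.
have {}h1 : (v ord0 i - o) * g * (t - s) <= (Q t - Q s) ord0 i.
  by apply: h1 => r /h'; rewrite ler_norml => /andP[]; lra.
have {}h2 : (Q t - Q s) ord0 i <= (v ord0 i + o) * g * (t - s).
  by apply: h2 => r /h'; rewrite ler_norml => /andP[]; lra.
move: h1 h2; rewrite !mxE => h1 h2.
by rewrite ler_norml; apply/andP; split; lra.
Qed.

(* Explicit Euler for the damping term multiplies P by 1 - x at each of the n + 1 steps. *)
Lemma momentum_recursion n delta a eta :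
  0 < delta -> delta <= T -> 0 <= a ->
  let h := delta / n.+1%:R in let x := g ^+ 2 * h in
  let tau (j : nat) := T - delta + j%:R * h in
  x <= 1 ->
  (forall t, 0 <= t <= T -> `|P t| <= a) ->
  (forall s t, 0 <= s <= T -> 0 <= t <= T -> `|s - t| <= h -> `|W s - W t| <= eta) ->
  `|P T - \sum_(j < n.+1) ((1 - x) ^+ (n - j) * (g * c)) *: (W (tau j.+1) - W (tau j))|
  <= (1 - x) ^+ n.+1 * a + (MF / g + g * (MF * h + c * eta + g * h * a)).
Proof.
move=> delta0 dT a0 h x tau x1 Pa Weta.
have h0 : 0 < h by rewrite divr_gt0.
have tauS j : tau j.+1 = tau j + h by rewrite /tau -natr1 mulrDl mul1r addrA.
have tau_in j : (j <= n.+1)%N -> 0 <= tau j <= T.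
  move=> jn; apply/andP; split; first by rewrite addr_ge0 ?subr_ge0// mulr_ge0// ltW.
  rewrite /tau -lerBrDl opprB addrC subrK /h mulrCA ler_piMr ?(ltW delta0)//.
  by rewrite ler_pdivrMr// mul1r ler_nat.
have eta0 : 0 <= eta.
  have z : 0 <= (0 : R) <= T by rewrite lexx ltW.
  have z' : `|0 - 0 : R| <= h by rewrite subrr normr0 ltW.
  exact: le_trans (normr_ge0 _) (Weta 0 0 z z z').
(* A bound for the variation of P over one step: drift, noise and friction, the last with P at most
   [a]. *)
set o := g * (MF * h + c * eta + g * h * a).
have o0 : 0 <= o by rewrite mulr_ge0 ?(ltW g0)// !addr_ge0 ?mulr_ge0// ltW.
have x0 : 0 < x by rewrite mulr_gt0// exprn_gt0.
pose S j : 'rV[R]_d := \sum_(i < j) ((1 - x) ^+ (j - i.+1) * (g * c)) *: (W (tau i.+1) - W (tau i)).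
have SS j : S j.+1 = (1 - x) *: S j + (g * c) *: (W (tau j.+1) - W (tau j)).
  rewrite /S big_ord_recr/= subnn expr0 mul1r; congr (_ + _).
  rewrite scaler_sumr; apply: eq_bigr => i _; rewrite scalerA; congr (_ *: _).
  by rewrite subSn// exprS mulrA.
(* One step multiplies the error by 1 - x and adds at most x (MF / g + o), so MF / g + o is the
   fixed point of the recursion. *)
have PS j : (j <= n.+1)%N -> `|P (tau j) - S j| <= (1 - x) ^+ j * a + (MF / g + o).
  elim: j => [_|j IH jn].
    rewrite /S big_ord0 subr0 expr0 mul1r (le_trans (Pa _ (tau_in _ _)))// lerDl.
    by rewrite addr_ge0// divr_ge0// ltW.
  have {}IH := IH (ltnW jn).
  have /andP[j0 jT] := tau_in j (ltnW jn); have /andP[j10 j1T] := tau_in j.+1 jn.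
  have jj : tau j <= tau j.+1 by rewrite tauS lerDl ltW.
  have stepo r : tau j <= r <= tau j.+1 -> `|P r - P (tau j)| <= o.
    move=> /andP[jr rj]; have rT := le_trans rj j1T; have r0 := le_trans j0 jr.
    have rh : r - tau j <= h by rewrite lerBlDl -tauS.
    rewrite balance// normrZ gtr0_norm// /o ler_pM2l// (le_trans (ler_normB _ _))// lerD//.
      rewrite (le_trans (ler_normD _ _))// lerD//.
        rewrite (le_trans (drift_bound F_bound drift j0 jr rT))//.
        by rewrite ler_wpM2l.
      rewrite normrZ ger0_norm// ler_wpM2l// Weta// ?r0 ?j0//.
      by rewrite ger0_norm// subr_ge0.
    have := @displacement_close (tau j) r 0 a j0 jr rT a0.
    rewrite scaler0 subr0 => disp; apply: le_trans (disp _) _.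
      move=> v /andP[jv vr]; rewrite subr0; apply: Pa.
      by rewrite (le_trans j0 jv) (le_trans vr rT).
    by rewrite ler_wpM2r// ler_wpM2l// ltW.
  have disp := displacement_close j0 jj j1T o0 stepo.
  have Ah := drift_bound F_bound drift j0 jj j1T.
  have th : tau j.+1 - tau j = h by rewrite tauS addrAC subrr add0r.
  rewrite (_ : P (tau j.+1) - S j.+1 = (1 - x) *: (P (tau j) - S j) +
     (g *: A (tau j) (tau j.+1) -
      g *: (Q (tau j.+1) - Q (tau j) - (g * (tau j.+1 - tau j)) *: P (tau j)))); last first.
    rewrite SS th -[P (tau j.+1)](subrK (P (tau j))) balance// /x.
    by apply/rowP => i; rewrite !mxE; ring.
  rewrite th in disp Ah *.
  rewrite (le_trans (ler_normD _ _))// normrZ ger0_norm ?subr_ge0//.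
  have e1 := ler_wpM2l (_ : 0 <= 1 - x) IH; rewrite subr_ge0 in e1.
  have {}e1 := e1 x1.
  have e2 : `|g *: A (tau j) (tau j.+1) - g *: (Q (tau j.+1) - Q (tau j) - (g * h) *: P (tau j))|
      <= x * (MF / g + o).
    rewrite (le_trans (ler_normB _ _))// !normrZ gtr0_norm//.
    rewrite mulrDr lerD//.
      rewrite (_ : x * (MF / g) = g * (MF * h)) ?ler_pM2l// /x.
      by field; rewrite gt_eqF.
    rewrite (_ : x * o = g * (g * h * o)) ?ler_pM2l// /x; ring.
  rewrite exprS; have := lerD e1 e2; lra.
have tauT : tau n.+1 = T by rewrite /tau /h mulrCA mulfV ?pnatr_eq0// mulr1 subrK.
have := PS n.+1 (leqnn _); rewrite tauT.
by rewrite /S; under [X in _ - X]eq_bigr do rewrite subSS.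
Qed.

End langevin_estimates.

(** * The two equations in integral form and in slow time *)

Section time_integrals.
Context {R : realType}.
Notation mu := (@lebesgue_measure R).
Implicit Types s t b : R.

Lemma integral_increment (f : R -> R) s t : {within `[0, +oo[, continuous f} ->
  0 <= s -> s <= t ->
  (forall b, (forall u, s <= u <= t -> b <= f u) ->
     b * (t - s) <= \int[mu]_(u in `[0, t]) f u - \int[mu]_(u in `[0, s]) f u) /\
  (forall b, (forall u, s <= u <= t -> f u <= b) ->
     \int[mu]_(u in `[0, t]) f u - \int[mu]_(u in `[0, s]) f u <= b * (t - s)).
Proof.
move=> cf s0 st.
have intf : mu.-integrable `[0, t] (EFin \o f).
  apply: continuous_compact_integrable; first exact: segment_compact.
  apply: continuous_subspaceW cf => u /=; rewrite !in_itv/= andbT => /andP[].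
  by [].
have intf' : mu.-integrable `]s, t] (EFin \o f).
  apply: integrableS intf => // u /=; rewrite !in_itv/= => /andP[su ->].
  by rewrite (le_trans s0)// ltW.
have -> : \int[mu]_(u in `[0, t]) f u - \int[mu]_(u in `[0, s]) f u =
    \int[mu]_(u in `]s, t]) f u.
  by apply: Rintegral_itvB => //; rewrite bnd_simp.
have cst b : \int[mu]_(u in `]s, t]) b = b * (t - s).
  rewrite Rintegral_cst// [X in fine X](lebesgue_measure_itv `]s, t])/= lte_fin.
  move: st; rewrite le_eqVlt => /predU1P[->|->//].
  by rewrite ltxx subrr.
have intc b : mu.-integrable `]s, t] (EFin \o (fun=> b)).
  apply: integrableS (_ : mu.-integrable `[s, t] _) => //.
    by move=> u /=; rewrite !in_itv/= => /andP[/ltW -> ->].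
  apply: continuous_compact_integrable; first exact: segment_compact.
  by apply: continuous_subspaceT; exact: cst_continuous.
split=> b fb; rewrite -cst; apply: le_Rintegral => //.
  by move=> u /=; rewrite in_itv/= => /andP[/ltW su ut]; apply: fb; rewrite su.
by move=> u /=; rewrite in_itv/= => /andP[/ltW su ut]; apply: fb; rewrite su.
Qed.

End time_integrals.

Section solutions.
Context {R : realType} {d : nat}.
Variables (F : 'rV[R]_d -> 'rV[R]_d) (L : R).
Hypothesis F_lip : forall x y, `|F x - F y| <= L * `|x - y|.
Hypothesis L0 : 0 <= L.
Implicit Types (s t : R) (f : R -> 'rV[R]_d).

Lemma within_continuous_coord f i : {within `[0, +oo[, continuous f} ->
  {within `[0, +oo[, continuous (fun s => f s ord0 i)}.
Proof.
move=> /subspace_continuousP cf; apply/subspace_continuousP => s s0.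
apply: (@cvg_comp _ _ _ f (fun v : 'rV[R]_d => v ord0 i) _ _ _ (cf s s0)).
exact: coord_continuous.
Qed.

Lemma within_continuous_lip f : {within `[0, +oo[, continuous f} ->
  {within `[0, +oo[, continuous (F \o f)}.
Proof.
move=> /subspace_continuousP cf; apply/subspace_continuousP => s s0.
apply/cvgrPdist_le => e e0; have L1 : 0 < L + 1 by rewrite ltr_wpDl.
have /cvgrPdist_le/(_ (e / (L + 1))) := cf s s0.
rewrite divr_gt0// => /(_ isT); apply: filterS => t ft.
rewrite (le_trans (F_lip _ _))// (le_trans (ler_wpM2l L0 ft))//.
by rewrite mulrA ler_pdivrMr// mulrC ler_pM2l// lerDl.
Qed.

Lemma time_integral_close f s t y e : {within `[0, +oo[, continuous f} ->
  0 <= s -> s <= t -> 0 <= e -> (forall u, s <= u <= t -> `|f u - y| <= e) ->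
  `|time_integral t f - time_integral s f - (t - s) *: y| <= e * (t - s).
Proof.
move=> cf s0 st e0 fy; apply/rV_norm_le => [|i]; first by rewrite mulr_ge0// subr_ge0.
have [lo up] := integral_increment (within_continuous_coord (i := i) cf) s0 st.
have fyi u : s <= u <= t -> `|f u ord0 i - y ord0 i| <= e.
  by move=> /fy; apply: le_trans; have := rV_coord_norm_le (f u - y) i; rewrite !mxE.
rewrite !mxE.
have {}lo : (y ord0 i - e) * (t - s) <= \int[lebesgue_measure]_(u in `[0, t]) f u ord0 i -
    \int[lebesgue_measure]_(u in `[0, s]) f u ord0 i.
  by apply: lo => u /fyi; rewrite ler_norml => /andP[]; lra.
have {}up : \int[lebesgue_measure]_(u in `[0, t]) f u ord0 i -
    \int[lebesgue_measure]_(u in `[0, s]) f u ord0 i <= (y ord0 i + e) * (t - s).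
  by apply: up => u /fyi; rewrite ler_norml => /andP[]; lra.
by rewrite ler_norml; apply/andP; split; lra.
Qed.

Lemma overdamped_drift_control T (Q : R -> 'rV[R]_d) : {within `[0, +oo[, continuous Q} ->
  drift_control F T Q (fun s t => time_integral t (F \o Q) - time_integral s (F \o Q)).
Proof.
move=> cQ s t y e s0 st tT Fy; apply: time_integral_close => //.
  exact: within_continuous_lip.
by apply: le_trans (Fy s _); rewrite ?lexx.
Qed.

Section langevin.
Variables (g beta : R) (b q p : R -> 'rV[R]_d).
Hypotheses (g0 : 0 < g) (beta0 : 0 < beta).
Hypotheses (cq : {within `[0, +oo[, continuous q}) (cp : {within `[0, +oo[, continuous p}).
Hypothesis sde : forall t, 0 <= t -> q t = q 0 + time_integral t p /\
  p t = p 0 + time_integral t (fun s => F (q s)) - time_integral t (fun s => g *: p s)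
        + Num.sqrt (2 * g * beta^-1) *: (b t - b 0).

(** This is int_s^t F(q_(g u)) du before the change of variables, which is never carried out:
    [drift_control] can be read off in fast time. *)
Definition slow_drift s t : 'rV[R]_d :=
  g^-1 *: (time_integral (g * t) (F \o q) - time_integral (g * s) (F \o q)).

Lemma slow_drift_control T : drift_control F T (fun t => q (g * t)) slow_drift.
Proof.
move=> s t y e s0 st tT Fy.
have e0 : 0 <= e by apply: le_trans (Fy s _); rewrite ?lexx.
have gs : 0 <= g * s by rewrite mulr_ge0// ltW.
have gst : g * s <= g * t by rewrite ler_pM2l.
have := @time_integral_close (F \o q) (g * s) (g * t) y e (within_continuous_lip cq) gs gst e0.
have -> : slow_drift s t - (t - s) *: y = g^-1 *: (time_integral (g * t) (F \o q) -
    time_integral (g * s) (F \o q) - (g * t - g * s) *: y).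
  by apply/rowP => i; rewrite /slow_drift !mxE; field; rewrite gt_eqF.
rewrite normrZ gtr0_norm ?invr_gt0// => h.
rewrite -(ler_pM2l g0) mulrA mulfV ?gt_eqF// mul1r.
rewrite [leRHS](_ : _ = e * (g * t - g * s)); last by ring.
apply: h => u /andP[su ut]; have := Fy (u / g).
rewrite /= mulrCA mulfV ?gt_eqF// mulr1; apply.
by rewrite ler_pdivlMr// ler_pdivrMr// mulrC su mulrC.
Qed.

Lemma langevin_velocity T s t i a : 0 <= s -> s <= t -> t <= T ->
  ((forall v, s <= v <= t -> a <= p (g * v) ord0 i) ->
    a * g * (t - s) <= (q (g * t) - q (g * s)) ord0 i) /\
  ((forall v, s <= v <= t -> p (g * v) ord0 i <= a) ->
    (q (g * t) - q (g * s)) ord0 i <= a * g * (t - s)).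
Proof.
move=> s0 st _.
have gs : 0 <= g * s by rewrite mulr_ge0// ltW.
have gst : g * s <= g * t by rewrite ler_pM2l.
have [-> _] := sde gs; have [-> _] := sde (le_trans gs gst).
have [lo up] := integral_increment (within_continuous_coord (i := i) cp) gs gst.
rewrite !mxE opprD addrACA subrr add0r -mulrA mulrBr.
have scale u : g * s <= u <= g * t -> s <= u / g <= t.
  by move=> /andP[su ut]; rewrite ler_pdivlMr// ler_pdivrMr// mulrC su mulrC.
have gK u : g * (u / g) = u by rewrite mulrCA mulfV ?gt_eqF// mulr1.
by split => h; [apply: lo|apply: up] => u /scale /h; rewrite gK.
Qed.

Lemma langevin_balance T s t : 0 <= s -> s <= t -> t <= T ->
  p (g * t) - p (g * s) = g *: (slow_drift s t +
    Num.sqrt (2 * beta^-1) *: ((Num.sqrt g)^-1 *: b (g * t) - (Num.sqrt g)^-1 *: b (g * s))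
    - (q (g * t) - q (g * s))).
Proof.
move=> s0 st _.
have gs : 0 <= g * s by rewrite mulr_ge0// ltW.
have gt : 0 <= g * t by rewrite mulr_ge0 ?(ltW g0)// (le_trans s0).
(* The accumulated friction is a displacement, by the equation for q. *)
have scaled u : 0 <= u -> time_integral u (fun s => g *: p s) = g *: (q u - q 0).
  move=> u0; have [-> _] := sde u0; rewrite addrC addKr; apply/rowP => i; rewrite !mxE.
  rewrite -RintegralZl//; first by apply: eq_Rintegral => v _; rewrite mxE.
  apply: continuous_compact_integrable; first exact: segment_compact.
  apply: continuous_subspaceW (within_continuous_coord (i := i) cp) => v /=.
  by rewrite !in_itv/= andbT => /andP[].
have [_ ->] := sde gs; have [_ ->] := sde gt.
rewrite !scaled// /slow_drift mulrAC sqrtrM; last by rewrite mulr_ge0// invr_ge0 ltW.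
have sg : Num.sqrt g != 0 by rewrite gt_eqF// sqrtr_gt0.
have gn : g != 0 by rewrite gt_eqF.
(* This turns the noise sqrt g (b (g t) - b (g s)) into g times an increment of the rescaled
   path. *)
have E : Num.sqrt g = g * (Num.sqrt g)^-1.
  by rewrite -{2}(sqr_sqrtr (ltW g0)) expr2 mulfK.
apply/rowP => i; rewrite !mxE {1 2}E; field.
by rewrite sg gn.
Qed.

End langevin.
End solutions.

(** * Comparison of the laws *)

Section auxiliary.
Context {R : realType}.

Lemma euler_ext {d : nat} (F : 'rV[R]_d -> 'rV[R]_d) (h c : R) q xi xi' k :
  (forall j, (j < k)%N -> xi j = xi' j) -> euler F h c q xi k = euler F h c q xi' k.
Proof.
elim: k => //= k IH xx; rewrite IH ?xx// => j jk.
by apply: xx; rewrite ltnW.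
Qed.

(** Chaining steps of length [delta] turns a small-scale bound into the crude bound on all of [0, T]
    that [momentum_bound] requires. *)
Lemma chained_increments {d : nat} (T delta eta : R) (W : R -> 'rV[R]_d) (m : nat) :
  0 < delta ->
  (forall s t, 0 <= s <= T -> 0 <= t <= T -> `|s - t| <= delta -> `|W s - W t| <= eta) ->
  forall s t, 0 <= s <= T -> 0 <= t <= T -> `|s - t| <= m%:R * delta ->
    `|W s - W t| <= m%:R * eta.
Proof.
move=> delta0 HW.
suff main : forall s t, 0 <= s -> s <= t -> t <= T -> t - s <= m%:R * delta ->
    `|W s - W t| <= m%:R * eta.
  move=> s t /andP[s0 sT] /andP[t0 tT].
  have [st|/ltW ts] := leP s t.
    by rewrite distrC ger0_norm ?subr_ge0// => h; exact: main.
  by rewrite ger0_norm ?subr_ge0// => h; rewrite distrC; exact: main.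
elim: m => [s t s0 st tT|m IH s t s0 st tT].
  rewrite !mul0r subr_le0 => ts; have -> : s = t by apply/eqP; rewrite eq_le st.
  by rewrite subrr normr0.
move=> tsm; have [td|dt] := leP (t - s) delta.
  have eta0 : `|W s - W t| <= eta.
    by apply: HW; rewrite ?s0 ?(le_trans s0 st) ?(le_trans st tT)// distrC ger0_norm ?subr_ge0.
  by rewrite (le_trans eta0)// ler_peMl ?ler1n// (le_trans _ eta0).
have sd : s <= s + delta by rewrite lerDl ltW.
have sdt : s + delta <= t by rewrite addrC -lerBrDr ltW.
rewrite -(subrKA (W (s + delta))) -natr1 mulrDl mul1r [leRHS]addrC.
rewrite (le_trans (ler_normD _ _))// lerD//.
  apply: HW; rewrite ?s0 ?(le_trans s0 sd) ?(le_trans sdt tT) ?(le_trans st tT)//.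
  by rewrite opprD addrA subrr add0r normrN ger0_norm// ltW.
apply: IH => //; first by rewrite (le_trans s0).
by move: tsm; rewrite -natr1 mulrDl mul1r; lra.
Qed.

(** Since (1 - x) (1 + x) is at most 1, Bernoulli's inequality for (1 + x)^N gives the bound. *)
Lemma relaxation_factor_le (x : R) N : 0 < x -> x < 1 ->
  (1 - x) ^+ N <= (1 + N%:R * x)^-1.
Proof.
move=> x0 x1.
have bern : 1 + N%:R * x <= (1 + x) ^+ N.
  elim: N => [|N IH]; first by rewrite mul0r addr0 expr0.
  rewrite exprS; apply: (@le_trans _ _ ((1 + x) * (1 + N%:R * x))).
    rewrite -natr1 mulrDl mul1r; have : 0 <= N%:R * x * x by rewrite !mulr_ge0// ltW.
    lra.
  by rewrite ler_pM2l// addr_gt0.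
have N0 : 0 < 1 + N%:R * x by rewrite ltr_pwDl// mulr_ge0// ltW.
have x1' : 0 <= 1 - x by lra.
rewrite -[leRHS]mul1r ler_pdivlMr// (le_trans (ler_wpM2l _ bern)) ?exprn_ge0//.
rewrite -exprMn exprn_ile1//.
  by rewrite mulr_ge0//; lra.
have -> : (1 - x) * (1 + x) = 1 - x ^+ 2 by ring.
by rewrite gerBl sqr_ge0.
Qed.

(** The variance of each coordinate of the weighted sum that replaces the momentum. With y = (1 -
    x)^2 it equals (2 / b) (1 - y^N) / (2 - x), which tends to 1 / b when x is small and N x is
    large. *)
Lemma geometric_variance (b x : R) (N : nat) : 0 < b -> 0 < x -> x < 1 ->
  `|\sum_(j < N) (2 * b^-1 * x) * (1 - x) ^+ (2 * (N.-1 - j)) - b^-1| <=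
  b^-1 * (x + 2 / (1 + N%:R * x)).
Proof.
move=> b0 x0 x1.
set y := (1 - x) ^+ 2.
have y0 : 0 <= y by rewrite sqr_ge0.
have -> : \sum_(j < N) (2 * b^-1 * x) * (1 - x) ^+ (2 * (N.-1 - j)) =
    (2 * b^-1 * x) * \sum_(j < N) y ^+ j.
  rewrite -mulr_sumr; congr (_ * _); case: N => [|N]; first by rewrite !big_ord0.
  rewrite [RHS](reindex_inj rev_ord_inj)/=; apply: eq_bigr => j _.
  by rewrite exprM subSS.
have geo : (2 - x) * x * \sum_(j < N) y ^+ j = 1 - y ^+ N.
  by rewrite -[RHS]opprB subrX1 -mulNr; congr (_ * _); rewrite /y; ring.
have x2 : 0 < 2 - x by lra.
have S : x * \sum_(j < N) y ^+ j = (1 - y ^+ N) / (2 - x).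
  by rewrite -geo; field; rewrite gt_eqF.
rewrite -!mulrA S (_ : _ - _ = b^-1 * ((x - 2 * y ^+ N) / (2 - x))); last first.
  by field; rewrite !gt_eqF.
have binv : 0 < b^-1 by rewrite invr_gt0.
rewrite normrM gtr0_norm// ler_pM2l// normrM [X in _ * X]gtr0_norm ?invr_gt0//.
have yN : y ^+ N <= (1 + N%:R * x)^-1.
  apply: le_trans (relaxation_factor_le N x0 x1).
  have y1 : y <= 1 - x.
    have : 0 <= x * (1 - x) by rewrite mulr_ge0 ?subr_ge0// ltW.
    rewrite /y; lra.
  by apply: lerXn2r => //; rewrite nnegrE// subr_ge0 ltW.
have yN0 : 0 <= y ^+ N by rewrite exprn_ge0.
rewrite ler_pdivrMr//.
have nb : `|x - 2 * y ^+ N| <= x + 2 * y ^+ N by rewrite ler_norml; apply/andP; split; lra.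
apply: (le_trans nb); apply: (@le_trans _ _ (x + 2 / (1 + N%:R * x))).
  by rewrite lerD2l ler_pM2l.
have z0 : 0 <= 2 / (1 + N%:R * x) by rewrite divr_ge0// addr_ge0// mulr_ge0// ltW.
by apply: ler_peMr; lra.
Qed.

End auxiliary.

Section good_events.
Context {R : realType} {disp : measure_display} {Omega : measurableType disp}.
Variable P : probability Omega R.

(** Where [U] or [V] is at least 1, the trivial bound 2 M is absorbed by 2 M U or 2 M V. *)
Lemma expectation_close_off_bad_events (M b : R) (X Y U V : Omega -> R) :
  bounded_rv M X -> bounded_rv M Y -> bounded_rv 1 U -> bounded_rv 1 V -> 0 <= b ->
  (forall w, 0 <= U w) -> (forall w, 0 <= V w) ->
  {ae P, forall w, U w < 1 -> V w < 1 -> `|X w - Y w| <= b} ->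
  `|\int[P]_w X w - \int[P]_w Y w| <=
    b + 2 * M * \int[P]_w U w + 2 * M * \int[P]_w V w.
Proof.
move=> bX bY bU bV b0 U0 V0 XY.
have scaled (Z : Omega -> R) : bounded_rv 1 Z -> bounded_rv (`|2 * M| * 1) (fun w => 2 * M * Z w).
  move=> [mZ bZ]; split; first exact: measurable_funM.
  by move=> w; rewrite normrM ler_wpM2l.
have bcst : bounded_rv `|b| (fun _ : Omega => b) by split.
have -> : b + 2 * M * \int[P]_w U w + 2 * M * \int[P]_w V w =
    \int[P]_w (b + 2 * M * U w + 2 * M * V w).
  rewrite RintegralD//; last 2 first.
  - exact: (bounded_rv_integrable P (bounded_rvD bcst (scaled _ bU))).
  - exact: (bounded_rv_integrable P (scaled _ bV)).
  rewrite RintegralD//; last 2 first.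
  - exact: (bounded_rv_integrable P bcst).
  - exact: (bounded_rv_integrable P (scaled _ bU)).
  rewrite mean_cst !RintegralZl//.
  - exact: (bounded_rv_integrable P bV).
  - exact: (bounded_rv_integrable P bU).
apply: (ae_expectation_close bX bY (bounded_rvD (bounded_rvD bcst (scaled _ bU)) (scaled _ bV))).
apply: filterS XY => w XY.
have M0 : 0 <= M by case: bX => _ /(_ w); apply: le_trans.
have MU : 0 <= 2 * M * U w by rewrite !mulr_ge0.
have MV : 0 <= 2 * M * V w by rewrite !mulr_ge0.
have XY2 : `|X w - Y w| <= 2 * M.
  rewrite (le_trans (ler_normB _ _))// mulr2n mulrDl mul1r lerD//.
    by case: bX => _.
  by case: bY => _.
have [U1|U1] := ltP (U w) 1; last first.
  rewrite (le_trans XY2)// -addrA addrCA addrC -[leLHS]addr0.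
  have : 2 * M * 1 <= 2 * M * U w by rewrite ler_wpM2l// mulr_ge0.
  lra.
have [V1|V1] := ltP (V w) 1; last first.
  have : 2 * M * 1 <= 2 * M * V w by rewrite ler_wpM2l// mulr_ge0.
  lra.
by have := XY U1 V1; lra.
Qed.

End good_events.

Section window_law.
Context {R : realType} {disp : measure_display} {Omega : measurableType disp}.
Variable P : probability Omega R.
Context {d : nat}.
Variable B : R -> Omega -> 'rV[R]_d.
Hypothesis B_brownian : brownian_motion P B.
Variables (F : 'rV[R]_d -> 'rV[R]_d) (L : R).
Hypothesis F_lip : forall x y, `|F x - F y| <= L * `|x - y|.
Hypothesis L0 : 0 <= L.
Variables (beta T : R) (q : 'rV[R]_d).
Hypotheses (beta0 : 0 < beta) (T0 : 0 < T).
Variables (k M : R) (h : (R -> 'rV[R]_d) -> 'rV[R]_d -> R).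
Hypotheses (h_lip : lipschitz_functional T k h) (k0 : 0 <= k).
Hypothesis h_bound : forall x v, `|h x v| <= M.

Notation c := (Num.sqrt (2 * beta^-1)).

Let B_rv t : 0 <= t -> random_vector (B t).
Proof. by case: B_brownian => + _ _ _ _ => /(_ t). Qed.

Definition grid n (j : nat) : R := T * j%:R / n.+1%:R.

Definition euler_path n (xi : nat -> 'rV[R]_d) t :=
  euler F (T / n.+1%:R) c q xi (frozen_index T n t).

Definition grid_increments n (W : R -> 'rV[R]_d) j := W (grid n j.+1) - W (grid n j).

Lemma euler_path_ext n xi xi' : (forall j, (j < n)%N -> xi j = xi' j) ->
  euler_path n xi = euler_path n xi'.
Proof.
move=> xx; apply/funext => t; apply: euler_ext => j jn; apply: xx.
by rewrite (leq_trans jn)// geq_minr.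
Qed.

Lemma finitely_continuous_euler (K : finType) n (xi : (K -> R) -> nat -> 'rV[R]_d)
    (v : (K -> R) -> 'rV[R]_d) Kv : 0 <= Kv ->
  (forall y y' r, 0 <= r -> (forall j, `|y j - y' j| <= r) ->
     (forall j, (j < n)%N -> `|xi y j - xi y' j| <= r) /\ `|v y - v y'| <= Kv * r) ->
  finitely_continuous (fun y => h (euler_path n (xi y)) (v y)).
Proof.
move=> Kv0 xv.
have h0 : 0 <= T / n.+1%:R by rewrite divr_ge0// ltW.
have [Ke Ke0 eul] := euler_lipschitz F_lip L0 q n h0 (sqrtr_ge0 (2 * beta^-1)).
apply: (lipschitz_finitely_continuous h_lip k0 (L := Ke + Kv)) => [y y' r r0 yy'|].
  have [xx vv] := xv y y' r r0 yy'; split => [t tT|].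
    apply: le_trans (eul _ _ r r0 xx _ _) _; first exact: geq_minr.
    by rewrite mulrDl lerDl mulr_ge0.
  by rewrite (le_trans vv)// mulrDl lerDr mulr_ge0.
exact: addr_ge0.
Qed.

(* The coefficients below are those of [momentum_recursion]: the last window of the
   rescaled path feeds the momentum, the earlier grid increments feed the position. *)
Lemma window_law g n m : 0 < g ->
  let delta := T / n.+1%:R in let h' := delta / m.+1%:R in let x := g ^+ 2 * h' in
  let tau (j : nat) := T - delta + j%:R * h' in
  let v := \sum_(j < m.+1) (2 * beta^-1 * x) * (1 - x) ^+ (2 * (m - j)) in
  x < 1 ->
  \int[P]_w h (euler_path n (grid_increments n (rescale B g ^~ w)))
    (\sum_(j < m.+1) ((1 - x) ^+ (m - j) * (g * c)) *:
       (rescale B g (tau j.+1) w - rescale B g (tau j) w)) =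
  \int[P]_w h (euler_path n (grid_increments n (B ^~ w)))
    (B (T - delta + v) w - B (T - delta) w).
Proof.
move=> g0 delta h' x tau v x1.
have delta0 : 0 < delta by rewrite divr_gt0.
have h'0 : 0 < h' by rewrite divr_gt0.
have x0 : 0 < x by rewrite mulr_gt0// exprn_gt0.
have sg : 0 < Num.sqrt g by rewrite sqrtr_gt0.
have c0 : 0 < c by rewrite sqrtr_gt0 mulr_gt0// invr_gt0.
have gridn : grid n n = T - delta.
  rewrite /grid /delta -natr1; field.
  by apply: lt0r_neq0; apply: ltr_wpDl.
have gridS j : grid n j.+1 - grid n j = delta.
  by rewrite /grid /delta -[j.+1%:R]natr1 mulrDr mulr1 mulrDl addrAC subrr add0r.
(* One increasing sequence of slow times: the coarse grid up to T - delta, then the fine subdivision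
   of the last interval. *)
pose sigma (j : nat) := if (j <= n)%N then grid n j else tau (j - n)%N.
have sigma_tau j : sigma (n + j)%N = tau j.
  rewrite /sigma; case: leqP; last by rewrite addKn.
  by rewrite -{2}[n]addn0 leq_add2l leqn0 => /eqP ->; rewrite addn0 gridn /tau mul0r addr0.
have tauS j : tau j.+1 - tau j = h' by rewrite /tau -natr1; ring.
have sigmaS j : sigma j.+1 - sigma j = if (j < n)%N then delta else h'.
  case: ltnP => jn; first by rewrite /sigma jn (ltnW jn).
  by rewrite -(subnKC jn) -addnS !sigma_tau.
(* The factor 1 / sqrt g comes from [rescale]; on the last interval the Euler weight of the momentum
   is included. *)
pose a (j : nat) : R := if (j < n)%N then (Num.sqrt g)^-1
  else (1 - x) ^+ (m - (j - n)) * (g * c) / Num.sqrt g.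
have a0 j : 0 < a j.
  by rewrite /a; case: ifP => _; rewrite ?divr_gt0 ?invr_gt0 ?mulr_gt0 ?exprn_gt0 ?subr_gt0.
pose s (j : nat) := g * sigma j.
(* Times for B obtained by accumulating variances: they reproduce the coarse grid up to index [n]
   and end at T - delta + v. *)
pose s' (j : nat) : R := \sum_(i < j) a i ^+ 2 * (s i.+1 - s i).
have s'S j : s' j.+1 - s' j = a j ^+ 2 * (s j.+1 - s j).
  by rewrite /s' big_ord_recr/= addrAC subrr add0r.
have s'_grid j : (j <= n)%N -> s' j = grid n j.
  elim: j => [_|j IH jn]; first by rewrite /s' big_ord0 /grid mulr0 mul0r.
  apply/eqP; rewrite -(subr_eq0 (s' _)) -[s' j.+1](subrK (s' j)) s'S IH ?(ltnW jn)//.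
  rewrite /s -mulrBr sigmaS /a jn exprVn sqr_sqrtr ?(ltW g0)// (mulKf (lt0r_neq0 g0)).
  by rewrite -(gridS j) subrK subrr.
have s'_end : s' (n + m.+1)%N = T - delta + v.
  rewrite /s' big_split_ord/= -/(s' n) s'_grid// gridn; congr (_ + _).
  apply: eq_bigr => j _; rewrite /s -mulrBr sigmaS /a ltnNge leq_addr/= addKn.
  have c2 : c ^+ 2 = 2 * beta^-1 by rewrite sqr_sqrtr// mulr_ge0// invr_ge0 ltW.
  have g2 : Num.sqrt g ^+ 2 = g by rewrite sqr_sqrtr// ltW.
  rewrite mulnC exprM /x; move: (_ ^+ (m - j)) => u.
  move: c2; move: c => cc <-.
  move: sg g2; move: (Num.sqrt g) => r r0 r2; rewrite -r2; field.
  exact: lt0r_neq0.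
pose N := (n + m).+1.
pose xi (y : 'I_N * 'I_d -> R) (j : nat) : 'rV[R]_d := \row_i y (inord j, i).
(* With the weights absorbed in the times, the momentum is a plain sum, which telescopes to a single
   increment of B. *)
pose vv (y : 'I_N * 'I_d -> R) : 'rV[R]_d := \row_i \sum_(j < m.+1) y (inord (n + j), i).
have cH : finitely_continuous (fun y => h (euler_path n (xi y)) (vv y)).
  apply: (finitely_continuous_euler (Kv := m.+1%:R)) => // y y' r r0 yy'; split=> [j jn|].
    by apply/rV_norm_le => // i; rewrite !mxE.
  apply/rV_norm_le => [|i]; first by rewrite mulr_ge0.
  rewrite !mxE -sumrB; apply: le_trans (ler_norm_sum _ _ _) _.
  apply: (@le_trans _ _ (\sum_(j < m.+1) r)); first by apply: ler_sum => j _; exact: yy'.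
  by rewrite sumr_const card_ord mulr_natl.
have s_lt j : s j < s j.+1.
  by rewrite -subr_gt0 /s -mulrBr mulr_gt0// sigmaS; case: ifP.
have s00 : 0 <= s 0%N by rewrite /s /sigma/= /grid mulr0 mul0r mulr0.
have s'00 : 0 <= s' 0%N by rewrite /s' big_ord0.
have law := scaled_brownian_increments_law B_brownian s00 s_lt s'00 a0 s'S cH
  (fun y => h_bound _ _).
have inordE j : (j <= n + m)%N -> (inord j : 'I_N) = j :> nat by move=> jN; rewrite inordK.
transitivity (\int[P]_w h (euler_path n (xi (fun ki => a ki.1 * (B (s ki.1.+1) w - B (s ki.1) w) ord0 ki.2)))
   (vv (fun ki => a ki.1 * (B (s ki.1.+1) w - B (s ki.1) w) ord0 ki.2))).
  apply: eq_Rintegral => w _; congr (h _ _).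
    apply: euler_path_ext => j jn; apply/rowP => i; rewrite !mxE /= inordE; last first.
      by rewrite (leq_trans (ltnW jn))// leq_addr.
    by rewrite /a jn /s /sigma jn (ltnW jn) mulrBr.
  apply/rowP => i; rewrite summxE !mxE; apply: eq_bigr => j _.
  rewrite !mxE/= inordE; last by rewrite leq_add2l -ltnS.
  rewrite /a ltnNge leq_addr/= addKn /s -addnS !sigma_tau; field.
  exact: lt0r_neq0.
rewrite law; apply: eq_Rintegral => w _; congr (h _ _).
  apply: euler_path_ext => j jn; apply/rowP => i; rewrite !mxE /= inordE; last first.
    by rewrite (leq_trans (ltnW jn))// leq_addr.
  by rewrite !s'_grid// ltnW.
apply/rowP => i; rewrite !mxE.
transitivity (\sum_(j < m.+1) (B (s' (n + j).+1) w ord0 i - B (s' (n + j)%N) w ord0 i)).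
  apply: eq_bigr => j _; rewrite !mxE/= inordE//; first by rewrite leq_add2l -ltnS.
rewrite -(big_mkord xpredT (fun j => B (s' (n + j).+1) w ord0 i - B (s' (n + j)%N) w ord0 i)).
under eq_bigr do rewrite -addnS.
rewrite (telescope_sumr (fun j => B (s' (n + j)%N) w ord0 i))//.
by rewrite addn0 s'_end s'_grid// gridn.
Qed.

End window_law.

Section random_vectors.
Context {R : realType} {disp : measure_display} {Omega : measurableType disp} {d : nat}.
Implicit Types X Y : Omega -> 'rV[R]_d.

Lemma random_vectorB X Y : random_vector X -> random_vector Y ->
  random_vector (fun w => X w - Y w).
Proof.
move=> rX rY i; rewrite (_ : (fun w => _) = (fun w => X w ord0 i - Y w ord0 i)).
  by apply: measurable_funB; [exact: rX|exact: rY].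
by apply/funext => w; rewrite !mxE.
Qed.

Lemma random_vector_sumZ n (a : nat -> R) (X : nat -> Omega -> 'rV[R]_d) :
  (forall j, random_vector (X j)) -> random_vector (fun w => \sum_(j < n) a j *: X j w).
Proof.
move=> rX i; rewrite (_ : (fun w => _) = (fun w => \sum_(j < n) a j * X j w ord0 i)).
  by apply: measurable_sum => j; apply: measurable_funM => //; exact: rX.
by apply/funext => w; rewrite summxE; apply: eq_bigr => j _; rewrite mxE.
Qed.

End random_vectors.

(** * Error bounds for a bounded Lipschitz functional *)

Section lipschitz_errors.
Context {R : realType} {disp : measure_display} {Omega : measurableType disp}.
Variable P : probability Omega R.
Context {d : nat}.
Variable B : R -> Omega -> 'rV[R]_d.
Hypothesis B_brownian : brownian_motion P B.
Variables (F : 'rV[R]_d -> 'rV[R]_d) (L MF : R).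
Hypothesis F_lip : forall x y, `|F x - F y| <= L * `|x - y|.
Hypothesis L0 : 0 <= L.
Hypothesis F_bound : forall x, `|F x| <= MF.
Variables (beta T : R) (q p : 'rV[R]_d).
Hypotheses (beta0 : 0 < beta) (T0 : 0 < T).
Variables (k M : R) (h : (R -> 'rV[R]_d) -> 'rV[R]_d -> R).
Hypotheses (h_lip : lipschitz_functional T k h) (k0 : 0 <= k).
Hypothesis h_bound : forall x v, `|h x v| <= M.

Notation c := (Num.sqrt (2 * beta^-1)).
Notation Psi S delta eta x := (oscillation S delta eta x).
Notation epath := (euler_path F beta T q).

Let B_rv t : 0 <= t -> random_vector (B t).
Proof. by case: B_brownian => + _ _ _ _ => /(_ t). Qed.

Let c0 : 0 <= c. Proof. exact: sqrtr_ge0. Qed.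

Lemma grid_in n (j : nat) : (j <= n.+1)%N -> 0 <= grid T n j <= T.
Proof. exact: step_time_bounds. Qed.

Lemma grid_ge0 n j : 0 <= grid T n j.
Proof. by rewrite divr_ge0// mulr_ge0// ltW. Qed.

Lemma frozen_index_grid n (j : nat) : (j <= n)%N -> frozen_index T n (grid T n j) = j.
Proof.
move=> jn; rewrite /frozen_index /step_index /grid.
rewrite divfK ?pnatr_eq0// mulrC mulKf ?gt_eqF// natrK.
exact/minn_idPl.
Qed.

Lemma bounded_rv_euler_path n (xi : Omega -> nat -> 'rV[R]_d) (v : Omega -> 'rV[R]_d) :
  (forall j, random_vector (xi ^~ j)) -> random_vector v ->
  bounded_rv M (fun w => h (epath n (xi w)) (v w)).
Proof.
move=> rxi rv.
pose J := ('I_n.+1 * 'I_d + 'I_d)%type.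
pose V (w : Omega) (j : J) := match j with
  | inl (j, i) => xi w j ord0 i | inr i => v w ord0 i end.
pose xx (y : J -> R) (j : nat) : 'rV[R]_d := \row_i y (inl (inord j, i)).
pose vv (y : J -> R) : 'rV[R]_d := \row_i y (inr i).
have -> : (fun w => h (epath n (xi w)) (v w)) =
          (fun w => (fun y => h (epath n (xx y)) (vv y)) (V w)).
  apply/funext => w /=; congr (h _ _); last by apply/rowP => i; rewrite !mxE.
  apply: euler_path_ext => j jn; apply/rowP => i; rewrite !mxE /V inordK//.
  by rewrite ltnW.
apply: (@bounded_rv_finitely_continuous _ _ _ P J M V (fun y => h (epath n (xx y)) (vv y))).
- by move=> [[j i]|i] /=; [exact: rxi|exact: rv].
- apply: (@finitely_continuous_euler _ _ F L F_lip L0 beta T q T0 k h h_lip k0 _ n xx vv 1) => // y y' r r0 yy'.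
  rewrite mul1r; split=> [j _|]; apply/rV_norm_le => // i; rewrite !mxE; exact: yy'.
- by move=> y; exact: h_bound.
Qed.

Lemma bounded_rv_oscillation_B S delta eta : 0 < S -> 0 < eta -> 0 <= delta ->
  bounded_rv 1 (fun w => Psi S delta eta (B ^~ w)).
Proof.
move=> S0 eta0 delta0; apply: (bounded_rv_oscillation P S0 eta0 delta0).
- by move=> t /andP[t0 _]; exact: B_rv.
- by move=> w; exact: (uniformly_continuous_brownian B_brownian).
Qed.

Lemma bounded_rv_oscillation_rescale g S delta eta : 0 < g -> 0 < S -> 0 < eta -> 0 <= delta ->
  bounded_rv 1 (fun w => Psi S delta eta (rescale B g ^~ w)).
Proof.
move=> g0 S0 eta0 delta0; apply: (bounded_rv_oscillation P S0 eta0 delta0).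
- by move=> t /andP[t0 _]; exact: (random_vector_rescale B_brownian).
- by move=> w; exact: (uniformly_continuous_rescale B_brownian).
Qed.

Lemma uniformly_continuous_time_change g (X : R -> 'rV[R]_d) : 0 < g ->
  {within `[0, +oo[, continuous X} -> uniformly_continuous_upto T (fun t => X (g * t)).
Proof.
move=> g0 cX e e0; have [r r0 hr] := heine (g * T) cX e0.
exists (r / g); first by rewrite divr_gt0.
move=> s t /andP[s0 sT] /andP[t0 tT] st; apply: hr.
- by rewrite mulr_ge0 ?(ltW g0)//= ler_pM2l.
- by rewrite mulr_ge0 ?(ltW g0)//= ler_pM2l.
by rewrite -mulrBr normrM gtr0_norm// mulrC -ler_pdivlMr.
Qed.

Section adapted_processes.
Variable X : R -> Omega -> 'rV[R]_d.
Hypothesis X_adapted : adapted P B X.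

Lemma adapted_random_vector t : 0 <= t -> random_vector (X t).
Proof.
move=> t0 i _ U mU; rewrite setTI.
by apply: (augmented_filtration_measurable B_rv (t := t)); exact: X_adapted.
Qed.

End adapted_processes.

Section langevin.
Variables (g : R) (qL pL : R -> Omega -> 'rV[R]_d).
Hypothesis g0 : 0 < g.
Hypothesis L_sol : langevin_solution P F beta g B q p qL pL.

Lemma bounded_rv_langevin :
  bounded_rv M (fun w => h (fun t => qL (g * t) w) (pL (g * T) w)).
Proof.
case: L_sol => [[cq cp] [aq ap] _ _].
apply: (@bounded_rv_path_functional _ _ _ P d T T0 M k h (fun t => qL (g * t)) (pL (g * T)) h_lip k0 h_bound).
- by move=> t /andP[t0 _]; apply: (adapted_random_vector aq); rewrite mulr_ge0// ltW.
- by move=> w; exact: (uniformly_continuous_time_change g0 (cq w)).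
- by apply: (adapted_random_vector ap); rewrite mulr_ge0// ltW.
Qed.

(** The momentum needs only the crude bound g rho, since the position sees P / g. The two
    oscillation terms serve the position, at mesh [delta] and level [eta], and the momentum, at mesh
    [h'] and level eta / g, because noise enters it with a factor [g]. *)
Lemma langevin_error n m rho eta e :
  let delta := T / n.+1%:R in let h' := delta / m.+1%:R in let x := g ^+ 2 * h' in
  let v := \sum_(j < m.+1) (2 * beta^-1 * x) * (1 - x) ^+ (2 * (m - j)) in
  x < 1 -> 0 < rho -> 0 < eta -> 0 <= e ->
  c * eta <= rho / 4 -> `|p| <= g * rho / 2 ->
  c * (n.+1%:R * eta) <= (g * (g * rho) / 2 - MF) * delta ->
  2 * (rho + (delta * MF + c * eta)) * expR (L * T) <= e ->
  (1 - x) ^+ m.+1 * (g * rho) +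
    (MF / g + g * (MF * h' + c * (eta / g) + g * h' * (g * rho))) <= e ->
  `|\int[P]_w h (fun t => qL (g * t) w) (pL (g * T) w) -
    \int[P]_w h (epath n (grid_increments T n (B ^~ w)))
      (B (T - delta + v) w - B (T - delta) w)| <=
  k * e + 2 * M * \int[P]_w Psi T delta eta (rescale B g ^~ w)
        + 2 * M * \int[P]_w Psi T h' (eta / g) (rescale B g ^~ w).
Proof.
move=> delta h' x v x1 rho0 eta0 e0 ceta prho noise E1 E2.
have delta0 : 0 < delta by rewrite divr_gt0.
have h'0 : 0 < h' by rewrite divr_gt0.
have deltaT : delta <= T by rewrite ler_pdivrMr// ler_peMr ?(ltW T0)// ler1n.
have etag0 : 0 < eta / g by rewrite divr_gt0.
(* From here both expectations involve the same W, and the comparison is pathwise. *)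
have -> := esym (window_law B_brownian F_lip L0 q beta0 T0 h_lip k0 h_bound g0 x1).
have W_rv t : 0 <= t -> random_vector (rescale B g t) by exact: (random_vector_rescale B_brownian).
apply: (expectation_close_off_bad_events (M := M)).
- exact: bounded_rv_langevin.
- apply: bounded_rv_euler_path.
    by move=> j; apply: random_vectorB; apply: W_rv; exact: grid_ge0.
  apply: (@random_vector_sumZ _ _ _ _ m.+1 (fun j => (1 - x) ^+ (m - j) * (g * c))
    (fun j w => rescale B g (T - delta + j.+1%:R * h') w - rescale B g (T - delta + j%:R * h') w)).
  by move=> j; apply: random_vectorB; apply: W_rv; rewrite addr_ge0 ?subr_ge0// mulr_ge0// ltW.
- by apply: bounded_rv_oscillation_rescale => //; exact: ltW.
- by apply: bounded_rv_oscillation_rescale => //; exact: ltW.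
- exact: mulr_ge0.
- by move=> w; apply: oscillation_ge0; exact: ltW.
- by move=> w; apply: oscillation_ge0; exact: ltW.
case: L_sol => [[cq cp] _ ae0 aeE].
apply: filterS2 ae0 aeE => w [q0 p0] sde U1 V1.
pose Q t := qL (g * t) w; pose Pp t := pL (g * t) w; pose W t := rescale B g t w.
pose A := slow_drift F g (qL ^~ w).
have drift : drift_control F T Q A by exact: (slow_drift_control F_lip L0 g0 (cq w)).
have balance s t : 0 <= s -> s <= t -> t <= T ->
    Pp t - Pp s = g *: (A s t + c *: (W t - W s) - (Q t - Q s)).
  exact: (@langevin_balance _ _ F g beta (B ^~ w) (qL ^~ w) (pL ^~ w) g0 beta0 (cp w) sde T).
have velo s t i b : 0 <= s -> s <= t -> t <= T ->
    (forall u, s <= u <= t -> b <= Pp u ord0 i) -> b * g * (t - s) <= (Q t - Q s) ord0 i.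
  by move=> s0 st tT; exact: (langevin_velocity g0 (cp w) sde i b s0 st tT).1.
have velo' s t i b : 0 <= s -> s <= t -> t <= T ->
    (forall u, s <= u <= t -> Pp u ord0 i <= b) -> (Q t - Q s) ord0 i <= b * g * (t - s).
  by move=> s0 st tT; exact: (langevin_velocity g0 (cp w) sde i b s0 st tT).2.
have oscU s t : 0 <= s <= T -> 0 <= t <= T -> `|s - t| <= delta -> `|W s - W t| <= eta.
  exact: (oscillation_lt1 eta0 U1).
have oscV s t : 0 <= s <= T -> 0 <= t <= T -> `|s - t| <= h' -> `|W s - W t| <= eta / g.
  exact: (oscillation_lt1 etag0 V1).
have cP : uniformly_continuous_upto T Pp by exact: (uniformly_continuous_time_change g0 (cp w)).
have Pbound t : 0 <= t <= T -> `|Pp t| <= g * rho.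
  apply: (momentum_bound F_bound g0 c0 cP drift balance velo velo'
    (delta := delta) (nu := c * eta) (K := c * (n.+1%:R * eta))) => //.
  - exact: mulr_gt0.
  - by rewrite !mulr_ge0// ltW.
  - by rewrite /Pp mulr0 p0.
  - by rewrite -mulrA ler_pM2l.
  - by move=> s t' hs ht st; rewrite ler_wpM2l// oscU.
  - move=> s t' hs ht; rewrite ler_wpM2l//.
    apply: (chained_increments delta0 oscU) => //.
    rewrite /delta mulrCA mulfV ?pnatr_eq0// mulr1.
    move: hs ht => /andP[s0 sT] /andP[t0 tT]; rewrite ler_norml; apply/andP; split; lra.
apply: h_lip => [t tT|].
  apply: le_trans E1.
  pose Y t := Q t + g^-1 *: Pp t.
  have YE s t' : 0 <= s -> s <= t' -> t' <= T -> Y t' - Y s = A s t' + c *: (W t' - W s).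
    move=> s0 st tT'.
    rewrite (_ : Y t' - Y s = (Q t' - Q s) + g^-1 *: (Pp t' - Pp s)); last first.
      by apply/rowP => i; rewrite !mxE; ring.
    rewrite balance// scalerA mulVf ?gt_eqF// scale1r.
    by rewrite addrC subrK.
  have YQ t' : 0 <= t' <= T -> `|Y t' - Q t'| <= rho.
    move=> tT'; rewrite /Y addrC addKr normrZ ger0_norm ?invr_ge0 ?(ltW g0)//.
    by rewrite ler_pdivrMl// Pbound.
  have Q0 : Q 0 = q by rewrite /Q mulr0 q0.
  exact: (euler_close F_bound F_lip L0 T0 c0 (ltW rho0) drift YE YQ Q0 oscU tT).
apply: le_trans E2.
exact: (momentum_recursion F_bound T0 g0 c0 drift balance velo velo' delta0 deltaT
  (ltW (mulr_gt0 g0 rho0)) (ltW x1) Pbound oscV).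
Qed.

End langevin.

Section overdamped.
Variable qbar : R -> Omega -> 'rV[R]_d.
Hypothesis qbar_sol : overdamped_solution P F beta B q qbar.
Variables (n : nat) (eta e : R).
Let delta := T / n.+1%:R.
Hypotheses (eta0 : 0 < eta) (e0 : 0 <= e).
Hypothesis E1 : 2 * (delta * MF + c * eta) * expR (L * T) <= e.

Let delta0 : 0 < delta. Proof. by rewrite divr_gt0. Qed.

(** For [qbar] this path uses finitely many times, none after T - delta: hence a box argument
    applies, and the path is independent of later increments of B. *)
Definition frozen_path (x : R -> 'rV[R]_d) t := x (grid T n (frozen_index T n t)).

Let qbar_rv t : 0 <= t -> random_vector (qbar t).
Proof. by case: qbar_sol => _ aq _ _; exact: adapted_random_vector. Qed.

Lemma overdamped_euler_close : {ae P, forall w, Psi T delta eta (B ^~ w) < 1 ->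
  forall t, 0 <= t <= T ->
   `|qbar t w - epath n (grid_increments T n (B ^~ w)) t| <= e}.
Proof.
case: qbar_sol => cq _ ae0 aeE.
apply: filterS2 ae0 aeE => w q0 sde U1 t tT.
apply: le_trans E1.
pose A s t := time_integral t (F \o (qbar ^~ w)) - time_integral s (F \o (qbar ^~ w)).
have drift : drift_control F T (qbar ^~ w) A by exact: (overdamped_drift_control F_lip L0 (cq w)).
have YE s t' : 0 <= s -> s <= t' -> t' <= T ->
    qbar t' w - qbar s w = A s t' + c *: (B t' w - B s w).
  move=> s0 st tT'; rewrite [in LHS](sde t') ?(le_trans s0)// [in LHS](sde s)//.
  by apply/rowP => i; rewrite /A !mxE; ring.
have YQ t' : 0 <= t' <= T -> `|qbar t' w - qbar t' w| <= 0 by rewrite subrr normr0.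
have oscU s t' : 0 <= s <= T -> 0 <= t' <= T -> `|s - t'| <= delta -> `|B s w - B t' w| <= eta.
  exact: (oscillation_lt1 eta0 U1).
have := euler_close F_bound F_lip L0 T0 c0 (lexx 0) drift YE YQ q0 oscU tT.
by rewrite add0r.
Qed.

Let J := ('I_n.+1 * 'I_d + 'I_d)%type.
Let frozen_vec (V : Omega -> 'rV[R]_d) (w : Omega) (j : J) : R := match j with
  | inl (j, i) => qbar (grid T n j) w ord0 i | inr i => V w ord0 i end.
Let vec_path (y : J -> R) t : 'rV[R]_d := \row_i y (inl (inord (frozen_index T n t), i)).
Let vec_end (y : J -> R) : 'rV[R]_d := \row_i y (inr i).

Let frozen_vecE V :
  \int[P]_w h (vec_path (frozen_vec V w)) (vec_end (frozen_vec V w)) =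
  \int[P]_w h (frozen_path (qbar ^~ w)) (V w).
Proof.
apply: eq_Rintegral => w _; congr (h _ _); last by apply/rowP => i; rewrite !mxE.
apply/funext => t; apply/rowP => i; rewrite !mxE /frozen_vec inordK//.
by rewrite ltnS geq_minr.
Qed.

Let frozen_measurable V : random_vector V ->
  forall j, measurable_fun setT (frozen_vec V ^~ j).
Proof.
move=> rV [[j i]|i] /=; last exact: rV.
by apply: qbar_rv; exact: grid_ge0.
Qed.

Let frozen_continuous : finitely_continuous (fun y => h (vec_path y) (vec_end y)).
Proof.
apply: (lipschitz_finitely_continuous h_lip k0 (L := 1)) => // y y' r r0 yy'.
by rewrite mul1r; split=> [t _|]; apply/rV_norm_le => // i; rewrite !mxE; exact: yy'.
Qed.

Let frozen_box V (U : J -> set R) :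
  [set w | forall j, U j (frozen_vec V w j)] =
  [set w | forall i, U (inr i) (V w ord0 i)] `&`
  [set w | forall (j : 'I_n.+1) i, U (inl (j, i)) (qbar (grid T n j) w ord0 i)].
Proof.
apply/seteqP; split => w /= hw.
  by split => [i|j i]; [exact: (hw (inr i))|exact: (hw (inl (j, i)))].
by case: hw => h1 h2 [[j i]|i] /=; [exact: h2|exact: h1].
Qed.

Let grid_last : grid T n n = T - delta.
Proof.
rewrite /grid /delta -natr1; field.
by apply: lt0r_neq0; apply: ltr_wpDl.
Qed.

Let T_delta : 0 <= T - delta.
Proof. by rewrite -grid_last grid_ge0. Qed.

Lemma bounded_rv_frozen_path (V : Omega -> 'rV[R]_d) : random_vector V ->
  bounded_rv M (fun w => h (frozen_path (qbar ^~ w)) (V w)).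
Proof.
move=> rV.
have := bounded_rv_finitely_continuous P (frozen_measurable rV) frozen_continuous
  (fun y => h_bound _ _).
congr (bounded_rv _ _); apply/funext => w; congr (h _ _); last first.
  by apply/rowP => i; rewrite !mxE.
apply/funext => t; apply/rowP => i; rewrite !mxE /frozen_vec inordK//.
by rewrite ltnS geq_minr.
Qed.

(** Two replacements at once: the scheme by [qbar] at its nodes, and the variance [v] by 1 / beta.
    The second moves the endpoint of an increment of B by at most [delta'], on a horizon long enough
    for any [v] up to 2 / beta. *)
Lemma overdamped_error v e' delta' : 0 < e' -> 0 <= delta' ->
  0 <= v <= 2 * beta^-1 -> `|v - beta^-1| <= delta' -> e' <= e ->
  `|\int[P]_w h (epath n (grid_increments T n (B ^~ w)))
      (B (T - delta + v) w - B (T - delta) w) -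
    \int[P]_w h (frozen_path (qbar ^~ w))
      (B (T - delta + beta^-1) w - B (T - delta) w)| <=
  k * e + 2 * M * \int[P]_w Psi T delta eta (B ^~ w)
        + 2 * M * \int[P]_w Psi (T + 2 * beta^-1) delta' e' (B ^~ w).
Proof.
move=> e'0 delta'0 /andP[v0 v2] vb e'e.
have ib : 0 < beta^-1 by rewrite invr_gt0.
have S0 : 0 < T + 2 * beta^-1 by rewrite addr_gt0// mulr_gt0.
apply: (expectation_close_off_bad_events (M := M)).
- apply: bounded_rv_euler_path.
    by move=> j; apply: random_vectorB; apply: B_rv; exact: grid_ge0.
  by apply: random_vectorB; apply: B_rv => //; rewrite addr_ge0.
- apply: bounded_rv_frozen_path.
  by apply: random_vectorB; apply: B_rv => //; rewrite addr_ge0// ltW.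
- by apply: bounded_rv_oscillation_B => //; exact: ltW.
- exact: bounded_rv_oscillation_B.
- exact: mulr_ge0.
- by move=> w; apply: oscillation_ge0; exact: ltW.
- by move=> w; apply: oscillation_ge0 => //; exact: ltW.
apply: filterS overdamped_euler_close => w close U1 V1.
apply: h_lip => [t tT|].
  have jn : (frozen_index T n t <= n)%N by exact: geq_minr.
  have := close U1 _ (grid_in (leqW jn)).
  by rewrite /euler_path frozen_index_grid// distrC.
rewrite (_ : _ - _ = B (T - delta + v) w - B (T - delta + beta^-1) w); last first.
  by apply/rowP => i; rewrite !mxE; ring.
apply: le_trans e'e; apply: (oscillation_lt1 e'0 V1).
- by rewrite addr_ge0//= lerD// lerBlDr lerDl ltW.
- rewrite addr_ge0 ?(ltW ib)//= lerD ?lerBlDr ?lerDl ?(ltW delta0)//.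
  by rewrite ler_peMl ?ler1n// ltW.
- by rewrite opprD addrACA subrr add0r.
Qed.

Lemma frozen_path_error (Z : Omega -> 'rV[R]_d) : random_vector Z ->
  `|\int[P]_w h (frozen_path (qbar ^~ w)) (Z w) - \int[P]_w h (qbar ^~ w) (Z w)| <=
  k * (2 * e) + 2 * M * \int[P]_w Psi T delta eta (B ^~ w).
Proof.
move=> rZ.
(* There is one bad event only; the second one is taken to be 0. *)
rewrite [leRHS](_ : _ = k * (2 * e) + 2 * M * \int[P]_w Psi T delta eta (B ^~ w)
   + 2 * M * \int[P]_w (0 : R)); last by rewrite mean_cst mulr0 addr0.
apply: (expectation_close_off_bad_events (M := M)).
- exact: bounded_rv_frozen_path.
- case: qbar_sol => cq _ _ _.
  apply: (bounded_rv_path_functional P T0 h_lip k0 h_bound) => //.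
  + by move=> t /andP[t0 _]; exact: qbar_rv.
  + by move=> w; exact: (heine T (cq w)).
- by apply: bounded_rv_oscillation_B => //; exact: ltW.
- by split => // w; rewrite normr0.
- by rewrite !mulr_ge0.
- by move=> w; apply: oscillation_ge0; exact: ltW.
- by [].
apply: filterS overdamped_euler_close => w close U1 _.
apply: h_lip => [t tT|]; last by rewrite subrr normr0 mulr_ge0.
have jn : (frozen_index T n t <= n)%N by exact: geq_minr.
have h1 := close U1 _ (grid_in (leqW jn)); have h2 := close U1 _ tT.
move: h1; rewrite {1}/euler_path frozen_index_grid// => h1.
(* The scheme takes the same value at [t] and at its node, so it serves as the intermediate point;
   hence 2 e. *)
rewrite -(subrKA (epath n (grid_increments T n (B ^~ w)) t)) mulr2n mulrDl mul1r.
by rewrite (le_trans (ler_normD _ _))// lerD// distrC.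
Qed.

(** Both endpoints are centred Gaussian with variance 1 / beta and independent of [qbar] at the
    nodes: the increment because [qbar] is adapted and the nodes precede T - delta, [Z] by
    assumption. Box probabilities therefore factor in the same way. *)
Lemma terminal_gaussian_law (Z : Omega -> 'rV[R]_d) :
  isotropic_gaussian P (Num.sqrt beta^-1) Z ->
  independent P (vector_sigma Z) (generated_sigma `[0, T] qbar) ->
  \int[P]_w h (frozen_path (qbar ^~ w)) (B (T - delta + beta^-1) w - B (T - delta) w) =
  \int[P]_w h (frozen_path (qbar ^~ w)) (Z w).
Proof.
move=> [rZ gZ] iZ.
have ib : 0 < beta^-1 by rewrite invr_gt0.
have rB : random_vector (fun w => B (T - delta + beta^-1) w - B (T - delta) w).
  by apply: random_vectorB; apply: B_rv => //; rewrite addr_ge0// ltW.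
rewrite -[LHS](frozen_vecE (fun w => B (T - delta + beta^-1) w - B (T - delta) w)) -[RHS]frozen_vecE.
apply: (expectation_eq_boxes (frozen_measurable rB) (frozen_measurable rZ)
  frozen_continuous (fun y => h_bound _ _)) => U mU.
rewrite !frozen_box.
have mUl (j : 'I_n.+1) i : measurable (U (inl (j, i))) by exact: mU.
have mUr i : measurable (U (inr i)) by exact: mU.
set A := [set w | forall j : 'I_n.+1, _].
have GA : generated_sigma `[0, T] qbar A.
  apply: (generated_sigma_box (X := qbar) (t := fun j : 'I_n.+1 => grid T n j)
    (U := fun j i => U (inl (j, i)))) => // j.
  by rewrite /= in_itv/= grid_in// ltnW.
have GZ := vector_sigma_box (X := Z) (U := fun i => U (inr i)) mUr.
case: qbar_sol => _ aq _ _.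
have gridj (j : 'I_n.+1) : 0 <= grid T n j <= T - delta.
  rewrite grid_ge0/= -grid_last.
  by rewrite /grid ler_pM2r ?invr_gt0// ler_pM2l// ler_nat -ltnS.
have lt : T - delta < T - delta + beta^-1 by rewrite ltrDl.
apply: (etrans (adapted_indep_increment B_brownian aq gridj T_delta lt mUl mUr)).
apply/esym; apply: (etrans (iZ _ _ GZ GA)); congr (_ * _)%E.
by rewrite addrAC subrr add0r; exact: gZ.
Qed.

End overdamped.
End lipschitz_errors.

(** * Choice of the parameters *)

Section lipschitz_convergence.
Context {R : realType} {disp : measure_display} {Omega : measurableType disp}.
Variable P : probability Omega R.
Context {d : nat}.
Variable B : R -> Omega -> 'rV[R]_d.
Hypothesis B_brownian : brownian_motion P B.
Variables (F : 'rV[R]_d -> 'rV[R]_d) (L MF : R).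
Hypothesis F_lip : forall x y, `|F x - F y| <= L * `|x - y|.
Hypothesis L0 : 0 <= L.
Hypothesis F_bound : forall x, `|F x| <= MF.
Variables (beta T : R) (q p : 'rV[R]_d).
Hypotheses (beta0 : 0 < beta) (T0 : 0 < T).
Variable qbar : R -> Omega -> 'rV[R]_d.
Hypothesis qbar_sol : overdamped_solution P F beta B q qbar.
Variables qL pL : R -> R -> Omega -> 'rV[R]_d.
Hypothesis L_sol : forall g, 0 < g -> langevin_solution P F beta g B q p (qL g) (pL g).
Variable Z : Omega -> 'rV[R]_d.
Hypothesis Z_gaussian : isotropic_gaussian P (Num.sqrt beta^-1) Z.
Hypothesis Z_indep : independent P (vector_sigma Z) (generated_sigma `[0, T] qbar).
Variables (k M : R) (h : (R -> 'rV[R]_d) -> 'rV[R]_d -> R).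
Hypotheses (h_lip : lipschitz_functional T k h) (k0 : 0 <= k).
Hypothesis h_bound : forall x v, `|h x v| <= M.

Notation c := (Num.sqrt (2 * beta^-1)).

Lemma exists_small_mesh (a z : R) : 0 < a -> 0 < z -> exists n : nat, a / n.+1%:R <= z.
Proof.
move=> a0 z0; have za : 0 < z / a by rewrite divr_gt0.
have [n _ /(_ n (leqnn n)) hn] := near_infty_natSinv_lt (PosNum za).
by exists n; rewrite -ler_pdivlMl// mulrC; exact: ltW.
Qed.

Lemma threshold_sum (a1 a2 a3 a4 a5 g : R) :
  0 <= a1 -> 0 <= a2 -> 0 <= a3 -> 0 <= a4 -> 0 <= a5 ->
  1 + a1 + a2 + a3 + a4 + a5 <= g ->
  [/\ 1 <= g, a1 <= g, a2 <= g, a3 <= g & a4 <= g /\ a5 <= g].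
Proof. by move=> *; split; [| | | |split]; lra. Qed.

Lemma combine_errors (eA eB eC eD N a b e u1 u2 u3 u4 : R) : 0 <= N ->
  `|eA - eB| <= k * a + 2 * N * u1 + 2 * N * u2 ->
  `|eB - eC| <= k * a + 2 * N * u3 + 2 * N * u4 ->
  `|eC - eD| <= k * (2 * a) + 2 * N * u3 ->
  u1 <= b -> u2 <= b -> u3 <= b -> u4 <= b ->
  4 * (k * a) <= e / 2 -> 10 * (N * b) <= e / 2 -> `|eA - eD| <= e.
Proof.
move=> N0 AB BC CD h1 h2 h3 h4 ka Nb.
have Nle y : y <= b -> N * y <= N * b by move=> yb; rewrite ler_wpM2l.
have := Nle _ h1; have := Nle _ h2; have := Nle _ h3; have := Nle _ h4.
have : `|eA - eD| <= `|eA - eB| + `|eB - eC| + `|eC - eD|.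
  rewrite (_ : eA - eD = (eA - eB) + (eB - eC) + (eC - eD)); last by ring.
  by rewrite (le_trans (ler_normD _ _))// lerD2r ler_normD.
lra.
Qed.

Lemma close_to_itv (v b : R) : `|v - b| <= b -> 0 <= v <= 2 * b.
Proof. by rewrite ler_norml => /andP[? ?]; apply/andP; split; lra. Qed.

Lemma damping_beats (a b g r : R) : g <= g ^+ 2 -> 0 < r -> 2 * (a + b) / r <= g ->
  b <= g * (g * r) / 2 - a.
Proof.
move=> gg r0 /le_trans/(_ gg); rewrite ler_pdivrMr// expr2; lra.
Qed.

Lemma forgetting (g a r b : R) : 0 <= b ->
  4 * r * g <= g * (a * b) * g -> g * r <= b / 4 * (1 + g ^+ 2 * a).
Proof. by rewrite expr2 => *; lra. Qed.

Lemma damp_le (a b : R) : 0 <= a -> 0 <= b -> b * (a / (a + 1)) <= b.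
Proof.
move=> a0 b0; rewrite ler_piMr// ler_pdivrMr ?ltr_wpDl//.
by rewrite mul1r lerDl.
Qed.

(** The order of choice is essential: [rho], [eta], [n] and [kap] are fixed before [g], and [m]
    after it. *)
Lemma lipschitz_convergence e : 0 < e -> exists g0, 0 < g0 /\ forall g, g0 <= g ->
  `|\int[P]_w h (fun t => qL g (g * t) w) (pL g (g * T) w) - \int[P]_w h (qbar ^~ w) (Z w)| <= e.
Proof.
move=> e0.
have M0 : 0 <= M by apply: le_trans (h_bound (fun=> 0) 0).
have MF0 : 0 <= MF by apply: le_trans (F_bound 0).
have c0 : 0 <= c by exact: sqrtr_ge0.
have ib : 0 < beta^-1 by rewrite invr_gt0.
pose e1 := e / (8 * (k + 1)).
have e10 : 0 < e1 by rewrite divr_gt0// mulr_gt0// ltr_wpDl.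
have ke1 : 4 * (k * e1) <= e / 2.
  have -> : 4 * (k * e1) = e / 2 * (k / (k + 1)).
    by rewrite /e1; field; apply: lt0r_neq0; rewrite ltr_wpDl.
  by apply: damp_le => //; rewrite divr_ge0 ?(ltW e0).
pose e2 := e / (20 * (M + 1)).
have e20 : 0 < e2 by rewrite divr_gt0// mulr_gt0// ltr_wpDl.
have Me2 : 10 * (M * e2) <= e / 2.
  have -> : 10 * (M * e2) = e / 2 * (M / (M + 1)).
    by rewrite /e2; field; apply: lt0r_neq0; rewrite ltr_wpDl.
  by apply: damp_le => //; rewrite divr_ge0 ?(ltW e0).
clearbody e1 e2.
pose G := expR (L * T).
have G1 : 1 <= G by rewrite -expR0 ler_expR mulr_ge0// ltW.
have G0 : 0 < G by exact: expR_gt0.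
pose rho := e1 / (8 * G).
have rho0 : 0 < rho by rewrite divr_gt0// mulr_gt0.
have rhoG : 8 * (rho * G) = e1 by rewrite /rho; field; exact: lt0r_neq0.
clearbody rho.
have rhoe : 8 * rho <= e1 by rewrite -rhoG ler_pM2l// ler_peMr// ltW.
pose eta := rho / (4 * (c + 1)).
have eta0 : 0 < eta by rewrite divr_gt0// mulr_gt0// ltr_wpDl.
have ceta : c * eta <= rho / 4.
  have -> : c * eta = rho / 4 * (c / (c + 1)).
    by rewrite /eta; field; apply: lt0r_neq0; rewrite ltr_wpDl.
  by apply: damp_le => //; rewrite divr_ge0 ?(ltW rho0).
clearbody eta.
have ceta0 : 0 <= c * eta by rewrite mulr_ge0// ltW.
have [d1 d10 Psi1] := oscillation_expectation_small B_brownian T0 eta0 e20.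
have S0 : 0 < T + 2 * beta^-1 by rewrite addr_gt0// mulr_gt0.
have [d2 d20 Psi2] := oscillation_expectation_small B_brownian S0 e10 e20.
(* The coarse mesh has to make the oscillation rare and the drift over one interval at most
   [rho]. *)
pose z1 := Num.min d1 (rho / (MF + 1)).
have z10 : 0 < z1 by rewrite lt_min d10 divr_gt0// ltr_wpDl.
have [n] := exists_small_mesh T0 z10.
rewrite le_min => /andP[dd1 dMF].
set delta := T / n.+1%:R in dd1 dMF.
have delta0 : 0 < delta by rewrite divr_gt0.
have {}dMF : delta * MF <= rho.
  move: dMF; rewrite ler_pdivlMr ?ltr_wpDl// => /(le_trans _) -> //.
  by rewrite ler_pM2l// lerDl.
have dd1' : 0 <= delta <= d1 by rewrite (ltW delta0).
have [PsiB1 PsiW1] := Psi1 delta dd1'.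
have dd2 : 0 <= d2 <= d2 by rewrite lexx (ltW d20).
have [PsiB2 _] := Psi2 d2 dd2.
have E1 : 2 * (rho + (delta * MF + c * eta)) * G <= e1.
  rewrite -rhoG; have : (rho + (delta * MF + c * eta)) * G <= (4 * rho) * G.
    by rewrite ler_wpM2r ?ltW//; lra.
  lra.
have E1' : 2 * (delta * MF + c * eta) * G <= e1.
  apply: le_trans E1; rewrite ler_wpM2r ?(ltW G0)// ler_wpM2l// lerDr; exact: ltW.
(* [kap] will bound both x and 2 / (g delta), the two terms of [geometric_variance]. The first entry
   keeps [v] within [d2] of 1 / beta; the second keeps [v] in [0, 2 / beta] and x below 1. *)
pose kap := Num.min (beta * d2 / 2) (1 / 2).
have kap0 : 0 < kap by rewrite lt_min !divr_gt0 ?mulr_gt0.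
have kap1 : kap <= 1 / 2 by rewrite ge_min lexx orbT.
have kap2 : kap <= beta * d2 / 2 by rewrite ge_min lexx.
clearbody kap.
(* Lower bounds for [g]: [A1] absorbs the initial momentum, [A2] lets damping beat the noise, [A3]
   makes the momentum at T - delta forgotten, [A4] makes MF / g small, and [A5] controls the tail of
   the variance. *)
pose A1 := 2 * `|p| / rho.
pose A2 := 2 * (MF + c * (n.+1%:R * eta) / delta) / rho.
pose A3 := 4 * rho / (delta * e1).
pose A4 := 4 * MF / e1.
pose A5 := 2 / (delta * kap).
have A10 : 0 <= A1 by rewrite /A1 divr_ge0 ?(ltW rho0)// mulr_ge0.
have A20 : 0 <= A2.
  rewrite /A2 divr_ge0 ?(ltW rho0)// mulr_ge0// addr_ge0// divr_ge0 ?(ltW delta0)//.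
  by rewrite mulr_ge0// mulr_ge0// ltW.
have A30 : 0 <= A3 by rewrite /A3 divr_ge0 ?mulr_ge0// ltW.
have A40 : 0 <= A4 by rewrite /A4 divr_ge0 ?(ltW e10)// mulr_ge0.
have A50 : 0 <= A5 by rewrite /A5 divr_ge0// mulr_ge0// ltW.
exists (1 + A1 + A2 + A3 + A4 + A5); split.
  by do 5!rewrite ltr_pwDl//.
move=> g /(threshold_sum A10 A20 A30 A40 A50)[g1 gA1 gA2 gA3 [gA4 gA5]].
have g0 : 0 < g by apply: lt_le_trans g1.
have gg : g <= g ^+ 2 by rewrite expr2 ler_peMr// ltW.
have etag0 : 0 < eta / g by rewrite divr_gt0.
(* The level eta / g depends on [g], hence so does [d3], and the fine mesh is chosen only now. *)
have [d3 d30 Psi3] := oscillation_expectation_small B_brownian T0 etag0 e20.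
(* The coefficient of [h'] in the error of [momentum_recursion]. *)
pose w := g * (MF + g * (g * rho)).
have w0 : 0 < w by rewrite mulr_gt0// ltr_wpDl// !mulr_gt0.
pose z2 := Num.min d3 (Num.min (kap / g ^+ 2) (e1 / 4 / w)).
have z20 : 0 < z2 by rewrite !lt_min d30 !divr_gt0// exprn_gt0.
have [m] := exists_small_mesh delta0 z20.
rewrite !le_min => /and3P[hd3 hkap hw].
set h' := delta / m.+1%:R in hd3 hkap hw.
have h'0 : 0 < h' by rewrite divr_gt0.
pose x := g ^+ 2 * h'.
have x0 : 0 < x by rewrite mulr_gt0// exprn_gt0.
have xkap : x <= kap by rewrite /x mulrC -ler_pdivlMr// exprn_gt0.
have x1 : x < 1.
  by rewrite (le_lt_trans (le_trans xkap kap1))// ltr_pdivrMr// mul1r ltr1n.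
have hd3' : 0 <= h' <= d3 by rewrite (ltW h'0).
have [_ PsiW3] := Psi3 h' hd3'.
have Nx : m.+1%:R * x = g ^+ 2 * delta.
  by rewrite /x mulrCA /h' [_ * (_ / _)]mulrCA mulfV ?pnatr_eq0// mulr1.
have gd : g * delta <= 1 + m.+1%:R * x.
  by rewrite Nx -[leLHS]add0r lerD// ler_pM2r.
have gd0 : 0 < g * delta by rewrite mulr_gt0.
have inv_gd : (1 + m.+1%:R * x)^-1 <= (g * delta)^-1.
  by rewrite lef_pV2 ?posrE// (lt_le_trans gd0).
pose v := \sum_(j < m.+1) (2 * beta^-1 * x) * (1 - x) ^+ (2 * (m - j)).
have v_close : `|v - beta^-1| <= beta^-1 * (kap + kap).
  apply: le_trans (geometric_variance m.+1 beta0 x0 x1) _.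
  rewrite ler_pM2l// lerD//.
  apply: (@le_trans _ _ (2 / (g * delta))); first by rewrite ler_pM2l.
  have : 2 / (delta * kap) * (delta * kap) <= g * (delta * kap).
    by apply: ler_wpM2r => //; rewrite mulr_ge0 ?(ltW kap0) ?(ltW delta0).
  rewrite divfK ?gt_eqF ?mulr_gt0// => gk.
  by rewrite ler_pdivrMr// mulrC -mulrA.
have kd2 : beta^-1 * (kap + kap) <= d2.
  rewrite mulrC ler_pdivrMr// mulrC (splitr (beta * d2)); exact: lerD.
have kb : beta^-1 * (kap + kap) <= beta^-1.
  by rewrite ler_piMr ?(ltW ib)// [leRHS](splitr 1) lerD.
have v_d2 : `|v - beta^-1| <= d2 by exact: le_trans kd2.
have v_in : 0 <= v <= 2 * beta^-1.
  exact/close_to_itv/(le_trans v_close kb).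
have noise : c * (n.+1%:R * eta) <= (g * (g * rho) / 2 - MF) * delta.
  by rewrite -ler_pdivrMr//; exact: (damping_beats gg rho0 gA2).
have prho : `|p| <= g * rho / 2.
  by rewrite ler_pdivlMr// mulrC -ler_pdivrMr.
have E2 : (1 - x) ^+ m.+1 * (g * rho) +
    (MF / g + g * (MF * h' + c * (eta / g) + g * h' * (g * rho))) <= e1.
  have t1 : (1 - x) ^+ m.+1 * (g * rho) <= e1 / 4.
    apply: (@le_trans _ _ ((1 + m.+1%:R * x)^-1 * (g * rho))).
      by rewrite ler_pM2r ?mulr_gt0//; exact: relaxation_factor_le.
    rewrite mulrC ler_pdivrMr; last by rewrite (lt_le_trans gd0).
    rewrite Nx; have : A3 * (delta * e1) <= g * (delta * e1) by rewrite ler_pM2r// mulr_gt0.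
    rewrite /A3 divfK ?gt_eqF ?mulr_gt0// => h3.
    have : 4 * rho * g <= g * (delta * e1) * g by rewrite ler_pM2r.
    exact/forgetting/ltW.
  have t2 : MF / g <= e1 / 4.
    rewrite ler_pdivrMr// mulrAC ler_pdivlMr// [leLHS]mulrC [leRHS]mulrC.
    by rewrite -ler_pdivrMr.
  have t3 : h' * w <= e1 / 4 by rewrite -ler_pdivlMr.
  have -> : g * (MF * h' + c * (eta / g) + g * h' * (g * rho)) = h' * w + c * eta.
    by rewrite /w; field; exact: lt0r_neq0.
  lra.
have errA := langevin_error B_brownian F_lip L0 F_bound beta0 T0 h_lip k0 h_bound g0 (L_sol g0)
  x1 rho0 eta0 (ltW e10) ceta prho noise E1 E2.
have errB := overdamped_error B_brownian F_lip L0 F_bound beta0 T0 h_lip k0 h_bound qbar_sol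
  eta0 (ltW e10) E1' e10 (ltW d20) v_in v_d2 (lexx e1).
have lawZ := terminal_gaussian_law B_brownian beta0 T0 h_lip k0 h_bound qbar_sol n Z_gaussian Z_indep.
have errC := frozen_path_error B_brownian F_lip L0 F_bound T0 h_lip k0 h_bound qbar_sol
  eta0 (ltW e10) E1' Z_gaussian.1.
rewrite lawZ in errB.
exact: (combine_errors M0 errA errB errC (PsiW1 g g0) (PsiW3 g g0) PsiB1 PsiB2 ke1 Me2).
Qed.

End lipschitz_convergence.

(** * Weak convergence *)

Section lipschitz_minorants.
Context {R : realType} {d : nat}.
Variable T : R.
Notation E := (@path_space R d T * 'rV[R]_d)%type.
Implicit Types (f : E -> R) (z : E) (x : R -> 'rV[R]_d) (v : 'rV[R]_d) (k r s e M : R).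

Lemma uniformly_continuous_within x : uniformly_continuous_upto T x ->
  {within `[0, T], continuous x}.
Proof.
move=> ux; apply/subspace_continuousP => s; rewrite /= in_itv/= => sT.
apply/cvgrPdist_le => e e0; have [r r0 hr] := ux e e0.
rewrite near_withinE; apply/nbhs_ballP; exists r => //= t; rewrite /ball/= => st.
by rewrite in_itv/= => tT; apply: hr => //; exact: ltW.
Qed.

Lemma restrict_pathE x (tau : set_type `[0, T]) :
  {within `[0, T], continuous x} -> (restrict_path T x : _ -> _) tau = x (val tau).
Proof.
move=> cx; rewrite /restrict_path; case: pselect => [//|nc].
by exfalso; apply: nc; apply/subspace_sigL_continuousP.
Qed.

Lemma path_space_modulus f z e : {for z, continuous f} -> 0 < e ->
  exists2 r, 0 < r & forall z' : E,
    (forall tau : set_type `[0, T], `|(z.1 : _ -> 'rV[R]_d) tau - (z'.1 : _ -> 'rV[R]_d) tau| < r) ->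
    `|z.2 - z'.2| < r -> `|f z - f z'| <= e.
Proof.
move=> /cvgrPdist_le/[apply]/nbhs_ballP[r /= r0 hr]; exists r => // z' h1 h2.
apply: hr; split => /=; last by rewrite -ball_normE.
by move=> tau; rewrite -ball_normE; exact: h1.
Qed.

(* An inf-convolution of f, extended to all functions R -> R^d and capped by M. *)
Definition lipschitz_minorant f M k x v : R :=
  inf ([set M] `|` [set a | exists (z : E) s, [/\ 0 <= s,
    forall tau : set_type `[0, T], `|x (val tau) - (z.1 : _ -> 'rV[R]_d) tau| <= s,
    `|v - z.2| <= s & a = f z + k * s]]).

Variables (f : E -> R) (M : R).
Hypothesis f_bound : forall z, `|f z| <= M.

Let f_ge z : - M <= f z. Proof. by have := f_bound z; rewrite ler_norml => /andP[]. Qed.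
Let f_le z : f z <= M. Proof. by have := f_bound z; rewrite ler_norml => /andP[]. Qed.
Let M_ge0 : 0 <= M.
Proof. by apply: le_trans (f_bound (restrict_path T (fun=> 0), 0)). Qed.

Lemma lipschitz_minorant_le k x v a : 0 <= k ->
  a = M \/ (exists (z : E) s, [/\ 0 <= s,
    forall tau : set_type `[0, T], `|x (val tau) - (z.1 : _ -> 'rV[R]_d) tau| <= s,
    `|v - z.2| <= s & a = f z + k * s]) -> lipschitz_minorant f M k x v <= a.
Proof.
move=> k0 ha; apply: ge_inf; last by case: ha; [left|right].
exists (- M) => _ [->|[z [s [s0 _ _ ->]]]]; first by rewrite ge0_cp.
by rewrite (le_trans (f_ge z))// lerDl mulr_ge0.
Qed.

Lemma le_lipschitz_minorant k x v b : b <= M ->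
  (forall (z : E) s, 0 <= s ->
    (forall tau : set_type `[0, T], `|x (val tau) - (z.1 : _ -> 'rV[R]_d) tau| <= s) ->
    `|v - z.2| <= s -> b <= f z + k * s) -> b <= lipschitz_minorant f M k x v.
Proof.
move=> bM h; apply: lb_le_inf; first by exists M; left.
by move=> _ [->//|[z [s [s0 h1 h2 ->]]]]; exact: h.
Qed.

Lemma lipschitz_minorant_bound k x v : 0 <= k -> `|lipschitz_minorant f M k x v| <= M.
Proof.
move=> k0; rewrite ler_norml; apply/andP; split; last first.
  by apply: lipschitz_minorant_le => //; left.
apply: le_lipschitz_minorant; first by rewrite ge0_cp.
by move=> z s s0 _ _; rewrite (le_trans (f_ge z))// lerDl mulr_ge0.
Qed.

(** A competitor at distance [s] from one argument is a competitor at distance s + r from the other,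
    at the extra cost k r. *)
Lemma lipschitz_minorant_lipschitz k : 0 <= k ->
  lipschitz_functional T k (lipschitz_minorant f M k).
Proof.
move=> k0.
have main x x' v v' r : (forall t, 0 <= t <= T -> `|x t - x' t| <= r) -> `|v - v'| <= r ->
    lipschitz_minorant f M k x v <= lipschitz_minorant f M k x' v' + k * r.
  move=> xx' vv'; have r0 : 0 <= r by apply: le_trans vv'.
  rewrite -lerBlDr; apply: le_lipschitz_minorant.
    by rewrite lerBlDr (le_trans (lipschitz_minorant_le (a := M) _ _))// ?lerDl ?mulr_ge0//; left.
  move=> z s s0 h1 h2; rewrite lerBlDr -addrA -mulrDr.
  apply: lipschitz_minorant_le => //; right; exists z, (s + r); split => //.
  - exact: addr_ge0.
  - move=> tau; have /= := set_valP tau; rewrite in_itv/= => tauT.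
    by rewrite -(subrKA (x' (val tau))) [leRHS]addrC (le_trans (ler_normD _ _))// lerD// xx'.
  - by rewrite -(subrKA v') [leRHS]addrC (le_trans (ler_normD _ _))// lerD.
move=> x x' v v' r xx' vv'; rewrite ler_norml; apply/andP; split.
  rewrite lerBrDr addrC lerBlDr; apply: main => [t tT|]; rewrite distrC//; exact: xx'.
by rewrite lerBlDl; exact: main.
Qed.

Lemma lipschitz_minorant_le_f k x v : 0 <= k -> {within `[0, T], continuous x} ->
  lipschitz_minorant f M k x v <= f (restrict_path T x, v).
Proof.
move=> k0 cx; apply: lipschitz_minorant_le => //; right.
exists (restrict_path T x, v), 0; split => //=.
- by move=> tau; rewrite restrict_pathE// subrr normr0.
- by rewrite subrr normr0.
- by rewrite mulr0 addr0.
Qed.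

(** A competitor closer than the modulus [r] has a value of [f] at least f - e; a farther one pays n
    r, which exceeds the total range 2 M for large n. *)
Lemma lipschitz_minorant_cvg x v : continuous f -> {within `[0, T], continuous x} ->
  lipschitz_minorant f M n%:R x v @[n --> \oo] --> f (restrict_path T x, v).
Proof.
move=> cf cx; apply/cvgrPdist_le => e e0.
have [r r0 hr] := path_space_modulus (cf (restrict_path T x, v)) e0.
near=> n.
rewrite ger0_norm; last by rewrite subr_ge0 lipschitz_minorant_le_f.
rewrite lerBlDl -lerBlDr; apply: le_lipschitz_minorant.
  by rewrite lerBlDr (le_trans (f_le _))// lerDl ltW.
move=> z s s0 h1 h2; rewrite lerBlDr.
have [sr|rs] := ltP s r.
  have /ler_normlW : `|f (restrict_path T x, v) - f z| <= e.
    apply: hr => [tau|] /=; last exact: le_lt_trans sr.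
    by rewrite restrict_pathE// (le_lt_trans (h1 tau)).
  by move=> fz; have : 0 <= n%:R * s; [rewrite mulr_ge0|lra].
have nr : 2 * M <= n%:R * r.
  rewrite -ler_pdivrMr//; near: n.
  exact: nbhs_infty_ger.
have : n%:R * r <= n%:R * s by rewrite ler_wpM2l.
have := f_le (restrict_path T x, v); have := f_ge z; lra.
Unshelve. all: by end_near. Qed.

End lipschitz_minorants.

Section weak_convergence.
Context {R : realType} {disp : measure_display} {Omega : measurableType disp}.
Variable P : probability Omega R.
Context {d : nat}.
Variable T : R.
Hypothesis T0 : 0 < T.
Notation E := (@path_space R d T * 'rV[R]_d)%type.
Implicit Types (X : R -> Omega -> 'rV[R]_d) (V : Omega -> 'rV[R]_d).

(** Measurability of [f] along the process comes from the minorants, so the path space needs no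
    sigma-algebra. *)
Lemma bounded_rv_path_space M (f : E -> R) X V : continuous f -> (forall z, `|f z| <= M) ->
  (forall t, 0 <= t <= T -> random_vector (X t)) ->
  (forall w, uniformly_continuous_upto T (X ^~ w)) -> random_vector V ->
  bounded_rv M (fun w => f (restrict_path T (X ^~ w), V w)) /\
  \int[P]_w lipschitz_minorant f M n%:R (X ^~ w) (V w) @[n --> \oo] -->
  \int[P]_w f (restrict_path T (X ^~ w), V w).
Proof.
move=> cf bf rX cX rV.
apply: (bounded_convergence P (X_ := fun n w => lipschitz_minorant f M n%:R (X ^~ w) (V w))).
- move=> n; apply: (bounded_rv_path_functional P T0 (k := n%:R)) => //.
  + exact: lipschitz_minorant_lipschitz.
  + by move=> x v; exact: lipschitz_minorant_bound.
- move=> w; apply: lipschitz_minorant_cvg => //.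
  exact: uniformly_continuous_within.
Qed.

Let half_gap (a b b' e : R) : - (e / 2) <= b' - b -> a - b <= e / 2 -> a - e <= b'.
Proof. by move=> *; lra. Qed.

(* Convergence against Lipschitz functionals of the whole path is enough, without
   tightness: f and -f are increasing limits of such functionals. *)
Lemma cvg_in_law_lipschitz (X : R -> R -> Omega -> 'rV[R]_d) (V : R -> Omega -> 'rV[R]_d) Y W :
  (forall g, 0 < g -> forall t, 0 <= t <= T -> random_vector (X g t)) ->
  (forall g, 0 < g -> forall w, uniformly_continuous_upto T (X g ^~ w)) ->
  (forall g, 0 < g -> random_vector (V g)) ->
  (forall t, 0 <= t <= T -> random_vector (Y t)) ->
  (forall w, uniformly_continuous_upto T (Y ^~ w)) -> random_vector W ->
  (forall k M (h : (R -> 'rV[R]_d) -> 'rV[R]_d -> R), lipschitz_functional T k h ->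
    0 <= k -> (forall x v, `|h x v| <= M) -> forall e, 0 < e ->
    exists g0, 0 < g0 /\ forall g, g0 <= g ->
    `|\int[P]_w h (X g ^~ w) (V g w) - \int[P]_w h (Y ^~ w) (W w)| <= e) ->
  cvg_in_law P (E := E) (fun g w => (restrict_path T (X g ^~ w), V g w))
    (fun w => (restrict_path T (Y ^~ w), W w)).
Proof.
move=> rX cX rV rY cY rW conv f cf [M0 [_ bf']].
pose M := `|M0| + 1.
have bf z : `|f z| <= M by apply: bf' => //; rewrite ltr_pwDr// ler_norm.
have lower (f' : E -> R) : continuous f' -> (forall z, `|f' z| <= M) ->
    forall e, 0 < e -> exists g0, 0 < g0 /\ forall g, g0 <= g ->
    \int[P]_w f' (restrict_path T (Y ^~ w), W w) - e <=
    \int[P]_w f' (restrict_path T (X g ^~ w), V g w).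
  move=> cf' bf'' e e0; have e2 : 0 < e / 2 by rewrite divr_gt0.
  have [_ /cvgrPdist_le/(_ _ e2)[n _ /(_ n (leqnn n)) hn]] := bounded_rv_path_space cf' bf'' rY cY rW.
  have [g0 [g00 hg]] := conv _ M _ (lipschitz_minorant_lipschitz bf'' (ler0n R n)) (ler0n R n)
    (fun x v => lipschitz_minorant_bound bf'' x v (ler0n R n)) _ e2.
  exists g0; split => // g gg0; have gp : 0 < g by exact: lt_le_trans gg0.
  have [bX _] := bounded_rv_path_space cf' bf'' (rX g gp) (cX g gp) (rV g gp).
  have := hg g gg0; rewrite ler_norml => /andP[h1 _].
  move: hn; rewrite ler_norml => /andP[_ h2].
  apply: (@le_trans _ _ (\int[P]_w lipschitz_minorant f' M n%:R (X g ^~ w) (V g w))); first exact: (half_gap h1 h2).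
  apply: (ae_le_expectation (M := M) (N := M)) => //.
    apply: (bounded_rv_path_functional P T0 (k := n%:R)) => //.
    + exact: lipschitz_minorant_lipschitz.
    + by move=> x v; exact: lipschitz_minorant_bound.
    + exact: rX.
    + exact: cX.
    + exact: rV.
  apply: aeW => w; apply: lipschitz_minorant_le_f => //.
  by apply: uniformly_continuous_within; exact: cX.
have finE Xf : bounded_rv M Xf -> ('E_P[Xf] = (\int[P]_w Xf w)%:E)%E.
  move=> bX; rewrite unlock /Rintegral fineK//.
  by apply: integrable_fin_num => //; exact: (bounded_rv_integrable P bX).
have [bY _] := bounded_rv_path_space cf bf rY cY rW.
rewrite (finE _ bY).
apply: cvg_EFin.
  near=> g; have gp : 0 < g by [].
  have [bX _] := bounded_rv_path_space cf bf (rX g gp) (cX g gp) (rV g gp).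
  by rewrite /= (finE _ bX).
apply/cvgrPdist_le => e e0.
have [g1 [g10 h1]] := lower f cf bf e e0.
have cfN : continuous (fun z => - f z) by move=> z; apply: cvgN; exact: cf.
have bfN z : `|- f z| <= M by rewrite normrN.
have [g2 [g20 h2]] := lower _ cfN bfN e e0.
near=> g; have gp : 0 < g by [].
have [bX _] := bounded_rv_path_space cf bf (rX g gp) (cX g gp) (rV g gp).
rewrite /= (finE _ bX) /=.
have {}h1 := h1 g _; have {}h2 := h2 g _.
have neg (Xf : Omega -> R) : bounded_rv M Xf -> \int[P]_w - Xf w = - \int[P]_w Xf w.
  move=> b; under eq_Rintegral do rewrite -mulN1r.
  by rewrite RintegralZl ?mulN1r//; exact: (bounded_rv_integrable P b).
rewrite (neg _ bY) (neg _ bX) in h2.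
rewrite ler_norml; apply/andP; split.
  have : g2 <= g by near: g; exact: (nbhs_pinfty_ge (num_real _)).
  by move/h2; lra.
have : g1 <= g by near: g; exact: (nbhs_pinfty_ge (num_real _)).
by move/h1; lra.
Unshelve. all: by end_near. Qed.

End weak_convergence.

Theorem theorem2p7 (R : realType) (disp : measure_display)
    (Omega : measurableType disp) (P : probability Omega R)
    (d : nat) (d_ge1 : (1 <= d)%N)
    (beta : R) (beta_gt0 : 0 < beta)
    (B : R -> Omega -> 'rV[R]_d) (B_brownian : brownian_motion P B)
    (F : 'rV[R]_d -> 'rV[R]_d)
    (F_smooth : smooth F) (F_bounded : bounded_fun F) (F_lipschitz : lipschitz F)
    (T : R) (T_gt0 : 0 < T) (q p : 'rV[R]_d)
    (qbar : R -> Omega -> 'rV[R]_d)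
    (qbar_sol : overdamped_solution P F beta B q qbar)
    (qL pL : R -> R -> Omega -> 'rV[R]_d)
    (L_sol : forall gamma, 0 < gamma ->
       langevin_solution P F beta gamma B q p (qL gamma) (pL gamma))
    (Z : Omega -> 'rV[R]_d)
    (Z_gaussian : isotropic_gaussian P (Num.sqrt beta^-1) Z)
    (Z_indep : independent P (vector_sigma Z) (generated_sigma `[0, T] qbar)) :
  cvg_in_law P (E := (path_space T * 'rV[R]_d)%type)
    (fun gamma w => (restrict_path T (fun t => qL gamma (gamma * t) w),
                     pL gamma (gamma * T) w))
    (fun w => (restrict_path T (fun t => qbar t w), Z w)).
Proof.
(* Boundedness and the Lipschitz property hold for every constant beyond some real number; the
   absolute value plus 1 lies beyond it and is nonnegative. *)
have [MF0 [_ bF]] := F_bounded.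
have F_bound x : `|F x| <= `|MF0| + 1 by apply: bF => //; rewrite ltr_pwDr// ler_norm.
have [L0 [_ lF]] := F_lipschitz.
have F_lip x y : `|F x - F y| <= (`|L0| + 1) * `|x - y|.
  by apply: (lF (`|L0| + 1) _ (x, y)) => //; rewrite ltr_pwDr// ler_norm.
have L_ge0 : 0 <= `|L0| + 1 by [].
apply: (@cvg_in_law_lipschitz _ _ _ P d T T_gt0 (fun g t => qL g (g * t)) (fun g => pL g (g * T)) qbar Z).
- move=> g g0 t /andP[t0 _]; have [_ [aq _] _ _] := L_sol g g0.
  by apply: (adapted_random_vector B_brownian aq); rewrite mulr_ge0// ltW.
- move=> g g0 w; have [[cq _] _ _ _] := L_sol g g0.
  exact: (uniformly_continuous_time_change T g0 (cq w)).
- move=> g g0; have [_ [_ ap] _ _] := L_sol g g0.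
  by apply: (adapted_random_vector B_brownian ap); rewrite mulr_ge0// ltW.
- move=> t /andP[t0 _]; have [_ aq _ _] := qbar_sol.
  exact: (adapted_random_vector B_brownian aq).
- by move=> w; have [cq _ _ _] := qbar_sol; exact: (heine T (cq w)).
- exact: Z_gaussian.1.
- move=> k M h h_lip k0 h_bound e e0.
  exact: (lipschitz_convergence B_brownian F_lip L_ge0 F_bound beta_gt0 T_gt0 qbar_sol L_sol
    Z_gaussian Z_indep h_lip k0 h_bound e0).
Qed.
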